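(* A functional $\ell:\mathrm{USC}\to[0,\infty)$ is the tail dependence functional of a max-stable random sup-measure on $E$ (which is then unique in distribution) if and only if (i) $\ell$ is homogeneous: $\ell(cf)=c\,\ell(f)$ for all $c>0$, $f\in\mathrm{USC}$; (ii) $\ell$ is max-completely alternating on $\mathrm{USC}$; and (iii) $\ell$ is upper semicontinuous: $\ell(f_n)\downarrow\ell(f)$ whenever $f_n,f\in\mathrm{USC}$ and $f_n\downarrow f$ pointwise.
   Context: $E$ is a locally compact Hausdorff second countable space; $\mathcal K$, $\mathcal G$ are its compact and open subsets. A sup-measure on $E$ is a map $\varphi$ from subsets of $E$ to $[0,\infty]$, finite on compact sets, which is a Choquet capacity (non-decreasing, $\varphi(\emptyset)=0$, $\varphi(A_n)\uparrow\varphi(A)$ if $A_n\uparrow A$, $\varphi(K_n)\downarrow\varphi(K)$ for compact $K_n\downarrow K$) and satisfies $\varphi(\bigcup_j G_j)=\sup_j\varphi(G_j)$ for every family of open sets. Sup-measures carry the sup-vague topology ($\varphi_n\to\varphi$ iff $\limsup\varphi_n(K)\le\varphi(K)$ for $K\in\mathcal K$ and $\liminf\varphi_n(G)\ge\varphi(G)$ for $G\in\mathcal G$) with its Borel $\sigma$-algebra; a random sup-measure is a random element of this space, its law is determined by the joint laws of $(X(K_1),\dots,X(K_m))$, $K_i\in\mathcal K$. $\mathrm{USC}$ is the family of bounded non-negative upper semicontinuous functions on $E$ with relatively compact support. Extremal integral: $\int^e f\,d\varphi=\sup\{\varphi(K)\inf_{x\in K}f(x):K\in\mathcal K\}$. A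 random variable is unit Fréchet with scale $a\ge0$ if its distribution function is $\exp(-a/t)$, $t>0$. A random sup-measure $X$ is (semi-simple) max-stable if for all $m$, $K_1,\dots,K_m\in\mathcal K$, $u\in[0,\infty)^m$, $\bigvee_i u_iX(K_i)$ is unit Fréchet (equivalently, $\int^e f\,dX$ is unit Fréchet for every $f\in\mathrm{USC}$); the scale parameter of $\int^e f\,dX$ is denoted $\ell(f)$ and $\ell$ is the tail dependence functional of $X$. $\ell$ is max-completely alternating if the differences $\Delta^\vee_{f_1}\ell(f)=\ell(f)-\ell(f\vee f_1)$, $\Delta^\vee_{f_n}\cdots\Delta^\vee_{f_1}\ell(f)=\Delta^\vee_{f_{n-1}}\cdots\Delta^\vee_{f_1}\ell(f)-\Delta^\vee_{f_{n-1}}\cdots\Delta^\vee_{f_1}\ell(f\vee f_n)$ are $\le0$ for all $n\ge1$, $f,f_1,\dots,f_n\in\mathrm{USC}$ ($\vee$ = pointwise maximum). *)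

(* Defs.v *)
From HB Require Import structures.
From mathcomp Require Import all_boot all_order all_algebra.
From mathcomp Require Import all_classical all_reals all_analysis.
Set Implicit Arguments. Unset Strict Implicit. Unset Printing Implicit Defensive.
Import Order.TTheory GRing.Theory Num.Theory.
Import numFieldNormedType.Exports.
Local Open Scope classical_set_scope.
Local Open Scope ring_scope.

Section SupMeasures.
Variables (E : topologicalType) (R : realType).

Definition LCHS : Prop :=
  locally_compact [set: E] /\ hausdorff_space E /\ @second_countable E.

Definition supmeasure (phi : set E -> \bar R) : Prop :=
  (forall A, (0 <= phi A)%E) /\
  (forall K, compact K -> (phi K < +oo)%E) /\
  phi set0 = 0%E /\
  (forall A B, A `<=` B -> (phi A <= phi B)%E) /\
  (forall (A : nat -> set E) (B : set E),
      {homo A : n m / (n <= m)%N >-> n `<=` m} ->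
      \bigcup_n A n = B -> phi (A n) @[n --> \oo] --> phi B) /\
  (forall (K : nat -> set E) (L : set E),
      (forall n, compact (K n)) ->
      {homo K : n m / (n <= m)%N >-> m `<=` n} ->
      \bigcap_n K n = L -> phi (K n) @[n --> \oo] --> phi L) /\
  (forall F : set (set E), F !=set0 -> (forall G, F G -> open G) ->
      phi (\bigcup_(G in F) G) = ereal_sup (phi @` F)).

Definition sv_subbase (U : set (set E -> \bar R)) : Prop :=
  (exists K (t : R), compact K /\ U = [set phi | (phi K < t%:E)%E]) \/
  (exists G (t : R), open G /\ U = [set phi | (t%:E < phi G)%E]).

Definition sv_open (U : set (set E -> \bar R)) : Prop :=
  exists F : set (set (set E -> \bar R)),
    (forall V, F V -> exists s : seq (set (set E -> \bar R)),
        (forall B, B \in s -> sv_subbase B) /\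
        V = \big[setI/setT]_(B <- s) B) /\
    U = supmeasure `&` \bigcup_(V in F) V.

Definition sv_borel : set (set (set E -> \bar R)) := <<s supmeasure, sv_open >>.

Definition random_supmeasure d (Omega : measurableType d)
    (X : Omega -> set E -> \bar R) : Prop :=
  (forall w, supmeasure (X w)) /\
  (forall U, sv_borel U -> measurable (X @^-1` U)).

Definition unit_frechet d (Omega : measurableType d) (P : probability Omega R)
    (Y : Omega -> \bar R) (a : R) : Prop :=
  0 <= a /\ forall t : R, 0 < t -> P [set w | (Y w <= t%:E)%E] = (expR (- (a / t)))%:E.

Definition USC (f : E -> R) : Prop :=
  [/\ (forall x, 0 <= f x), (exists M : R, forall x, f x <= M),
      (forall t : R, open [set x | f x < t]) &
      compact (closure [set x | f x != 0])].

Definition eint (f : E -> R) (phi : set E -> \bar R) : \bar R :=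
  ereal_sup [set (phi K * ereal_inf [set (f x)%:E | x in K])%E | K in compact].

Definition max_stable d (Omega : measurableType d) (P : probability Omega R)
    (X : Omega -> set E -> \bar R) : Prop :=
  random_supmeasure X /\
  forall s : seq (R * set E), (forall p, p \in s -> 0 <= p.1 /\ compact p.2) ->
    exists a : R, unit_frechet P
      (fun w => \big[maxe/0%E]_(p <- s) (p.1%:E * X w p.2)%E) a.

Definition tail_dep d (Omega : measurableType d) (P : probability Omega R)
    (X : Omega -> set E -> \bar R) (l : (E -> R) -> R) : Prop :=
  forall f, USC f -> unit_frechet P (fun w => eint f (X w)) (l f).

Definition fmax (f g : E -> R) : E -> R := fun x => Num.max (f x) (g x).

(* iterated max-differences; the list is [:: f_n; ...; f_1] *)
Fixpoint maxdiff (l : (E -> R) -> R) (fs : seq (E -> R)) (f : E -> R) : R :=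
  match fs with
  | [::] => l f
  | g :: gs => maxdiff l gs f - maxdiff l gs (fmax f g)
  end.

Definition homogeneous (l : (E -> R) -> R) : Prop :=
  forall (c : R) f, 0 < c -> USC f -> l (fun x => c * f x) = c * l f.

Definition max_completely_alternating (l : (E -> R) -> R) : Prop :=
  forall (fs : seq (E -> R)) f, fs != [::] -> (forall g, g \in fs -> USC g) ->
    USC f -> maxdiff l fs f <= 0.

Definition usc_functional (l : (E -> R) -> R) : Prop :=
  forall (fn : nat -> E -> R) f, (forall n, USC (fn n)) -> USC f ->
    (forall x, {homo (fun n => fn n x) : n m / (n <= m)%N >-> m <= n}) ->
    (forall x, fn n x @[n --> \oo] --> f x) ->
    {homo (fun n => l (fn n)) : n m / (n <= m)%N >-> m <= n} /\
    l (fn n) @[n --> \oo] --> l f.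

End SupMeasures.

(* Main.v *)
(** A sup-measure phi is determined by its upper semicontinuous density
    d x = phi {x}: phi A is the supremum of d over A, and eint f phi is the
    supremum of f * d.  By compactness, f * d < 1 everywhere iff f lies strictly
    below a finite maximum of functions q 1_K, K the closure of a set of a
    countable base, with q phi(K) < 1; this gives all measurability statements,
    and the events {eint f <= 1}, stable under intersection because
    eint (f \/ g) = eint f \/ eint g, generate the Borel sigma-algebra.

    Necessity: the max-differences of exp (- l / t) are the probabilities of
    {eint h <= t, eint g > t for all g in gs}, and
    l = lim t (1 - exp (- l / t)).

    Sufficiency: exp (- l) has non-negative max-differences, so it prescribes the
    joint law of countably many events, realized on [0, 1[ by successive
    subdivision into intervals; finite additivity suffices, no extension theorem
    is needed.  Applied to the events {q phi(K) <= 1}, this yields a random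
    density, and upper semicontinuity of l identifies the law of the extremal
    integrals. *)

Require Import Defs.
From HB Require Import structures.
From mathcomp Require Import all_boot all_order all_algebra.
From mathcomp Require Import all_classical all_reals all_analysis.
From mathcomp Require Import ring lra.
Import Order.TTheory GRing.Theory Num.Theory.
Import numFieldNormedType.Exports.
Local Open Scope classical_set_scope.
Local Open Scope ring_scope.
Set Implicit Arguments.
Unset Strict Implicit.
Unset Printing Implicit Defensive.

(** * Compactness and countable bases *)

(* The library's [compact_cover] is stated for pointed spaces only. *)
Lemma compact_seq_cover (T : topologicalType) (I : eqType) (K : set T)
    (Q : set I) (O : I -> set T) :
  compact K -> (forall i, Q i -> open (O i)) ->
  (forall x, K x -> exists2 i, Q i & O i x) ->
  exists2 s : seq I, (forall i, i \in s -> Q i) &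
    forall x, K x -> exists2 i, i \in s & O i x.
Proof.
move=> cK oO KO.
(* Finite lists ordered by inclusion form a filter; the near-covering form of compactness then
   yields one list that serves all points of [K]. *)
pose F := filter_from [set s : seq I | forall i, i \in s -> Q i]
  (fun s => [set s' : seq I | {subset s <= s'}]).
have FF : Filter F.
  apply: filter_from_filter; first by exists [::].
  move=> s t Qs Qt; exists (s ++ t) => /=.
    by move=> i; rewrite mem_cat => /orP[/Qs|/Qt].
  by move=> u stu; split=> i iu; apply: stu; rewrite mem_cat iu ?orbT.
have /compact_near_coveringP/(_ _ F (fun s x => exists2 i, i \in s & O i x) FF) := cK.
case.
  move=> x /KO[i Qi Oix]; exists (O i, [set s : seq I | i \in s]) => /=.
    split; first by apply: open_nbhs_nbhs; split => //; exact: oO.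
    exists [:: i] => /=; first by move=> j; rewrite inE => /eqP->.
    by move=> s /(_ i); apply; rewrite inE.
  by move=> [y s] /= [Oiy si]; exists i.
by move=> s Qs sP; exists s => //; exact: sP.
Qed.

(** Asking the closures to fit into neighbourhoods builds regularity into the base; numbering by
    [nat] keeps the later families of codes countable. *)
Definition nbhs_base (E : topologicalType) (b : nat -> set E) :=
  [/\ forall n, open (b n), forall n, compact (closure (b n)) &
      forall x V, nbhs x V -> exists2 n, b n x & closure (b n) `<=` V].

Lemma LCHS_nbhs_base (E : topologicalType) : LCHS E ->
  exists b : nat -> set E, nbhs_base b.
Proof.
move=> [lcE [hE [B /countable_injP[f finj] [Bo Bb]]]].
(* An index that is not the number of a base set with compact closure gives the empty union, which
   is harmless. *)
pose b n := \bigcup_(U in [set U | [/\ B U, compact (closure U) & f U = n]]) U.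
have bE U : B U -> compact (closure U) -> b (f U) = U.
  move=> BU cU; apply/seteqP; split => x; last by exists U.
  by case=> V [BV _ /finj VU] Vx; rewrite -VU ?inE.
exists b; split.
- by move=> n; apply: bigcup_open => U [/Bo].
- move=> n; have [[U [BU cU <-]]|nU] :=
    pselect (exists U, [/\ B U, compact (closure U) & f U = n]).
    by rewrite bE.
  suff -> : b n = set0 by rewrite closure0; exact: compact0.
  by rewrite -subset0 => x [U HU _]; apply: nU; exists U.
move=> x V xV; have [C xC [cC clC]] := lcE x I.
move: xC; rewrite withinET => xC.
have [W xW WV] := compact_regular hE cC xC xV.
have [U [BU Ux] UWC] := Bb x _ (filterI xW xC).
have UC : closure U `<=` C.
  rewrite (closure_id C).1//; apply: closure_subset => y /UWC[] //.
have cU : compact (closure U) by apply: subclosed_compact cC UC; exact: closed_closure.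
exists (f U); rewrite bE//; apply: subset_trans WV; apply: closure_subset.
by move=> y /UWC[].
Qed.

(** * Densities of sup-measures *)

Section SupMeasureDensity.
Context {E : topologicalType} {R : realType} {b : nat -> set E}.
Hypotheses (hE : hausdorff_space E) (hb : nbhs_base b).

Definition dens (phi : set E -> \bar R) (x : E) : R := fine (phi [set x]).

Lemma supmeasure_le phi A B : @supmeasure E R phi -> A `<=` B ->
  (phi A <= phi B)%E.
Proof. by move=> [_ [_ [_ [+ _]]]]; apply. Qed.

Lemma densE phi x : @supmeasure E R phi -> (dens phi x)%:E = phi [set x].
Proof.
move=> [p0 [pK _]]; apply: fineK.
by rewrite ge0_fin_numE//; apply: pK; exact: compact_set1.
Qed.

Lemma dens_ge0 phi x : @supmeasure E R phi -> 0 <= dens phi x.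
Proof. by move=> pS; case: (pS) => p0 _; rewrite -lee_fin densE. Qed.

Lemma dens_le phi x A : @supmeasure E R phi -> A x ->
  ((dens phi x)%:E <= phi A)%E.
Proof. by move=> pS Ax; rewrite densE//; apply: supmeasure_le => // _ ->. Qed.

(** Finite intersections of closures of base sets around [x] decrease to [[set x]]. Continuity along
    decreasing compact sets makes one of them have value below [t], and it contains the closure of a
    base set around [x]. *)
Lemma dens_lt_base phi x (t : R) : @supmeasure E R phi -> dens phi x < t ->
  exists2 n, b n x & (phi (closure (b n)) < t%:E)%E.
Proof.
move=> pS xt; have [ob cb xb] := hb.
have [n0 n0x _] := xb x setT filterT.
(* The default [closure (b n0)] makes every [c i] a closed neighbourhood of [x], including those
   whose [b i] misses [x]. *)
pose c i := if `[< b i x >] then closure (b i) else closure (b n0).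
have cx i : nbhs x (c i).
  rewrite /c; case: asboolP => [nx|_].
    apply: filterS (@subset_closure _ _) _.
    by apply: open_nbhs_nbhs; split; first exact: ob.
  apply: filterS (@subset_closure _ _) _.
  by apply: open_nbhs_nbhs; split; first exact: ob.
have cc i : closed (c i) by rewrite /c; case: ifP => _; exact: closed_closure.
pose L N := closure (b n0) `&` \big[setI/setT]_(i < N) c i.
have Lx N : nbhs x (L N).
  apply: filterI; first by have := cx n0; rewrite /c; case: ifP.
  by elim/big_ind : _ => //; do ?[exact: filterT | move=> *; exact: filterI].
have cL N : compact (L N).
  apply: compact_closedI => //.
  by elim/big_ind : _ => //; move=> *; exact: closedI.
have Lmono : {homo L : n m / (n <= m)%N >-> m `<=` n}.
  move=> n m nm y [y0 ym]; split => //.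
  move: ym; rewrite -!bigcap_mkord => ym i /= im.
  by apply: ym => /=; exact: leq_trans im nm.
have Lcap : \bigcap_n L n = [set x].
  apply/seteqP; split=> [y Ly|_ -> n _]; last exact: nbhs_singleton.
  apply/eqP/negP => /negP.
  rewrite eq_sym; move: hE; rewrite open_hausdorff => /[apply].
  move=> [[A B]] /=; rewrite !inE => -[Ax By] [oA oB AB].
  have [n nx nA] := xb x A (open_nbhs_nbhs (conj oA Ax)).
  have [_] := Ly n.+1 I; rewrite -bigcap_mkord => /(_ n (ltnSn n)).
  rewrite /c asboolT// => /nA Ay.
  by suff : (set0 : set E) y by []; rewrite -AB.
have := pS => -[_ [_ [_ [_ [_ [+ _]]]]]] => /(_ L _ cL Lmono Lcap) cvgL.
have [N Nt] : exists N, (phi (L N) < t%:E)%E.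
  apply/not_existsP => nt; move: xt; rewrite -lte_fin densE// ltNge => /negP; apply.
  apply: cvge_ge cvgL; apply: nearW => N.
  by rewrite leNgt; apply/negP; exact: nt.
have [n nx nL] := xb x _ (Lx N).
exists n => //; apply: le_lt_trans Nt; exact: supmeasure_le.
Qed.

Lemma open_dens_lt phi (t : R) : @supmeasure E R phi ->
  open [set x | dens phi x < t].
Proof.
move=> pS; rewrite openE => x /= /(dens_lt_base pS)[n nx nt].
have [ob _ _] := hb.
apply: (@filterS _ _ _ (b n)); last exact: open_nbhs_nbhs.
move=> y ny /=; rewrite -lte_fin; apply: le_lt_trans nt.
by apply: dens_le => //; exact: subset_closure.
Qed.

(** Conversely, [A] is covered by base sets of value below [t + e], and maxitivity on open sets
    bounds their union without any countability or compactness of [A]. *)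
Lemma supmeasure_leP phi A (t : R) : @supmeasure E R phi -> 0 <= t ->
  (phi A <= t%:E)%E <-> forall x, A x -> dens phi x <= t.
Proof.
move=> pS t0; split=> [At x Ax|At].
  by rewrite -lee_fin; apply: le_trans At; exact: dens_le.
apply/lee_addgt0Pr => e e0; rewrite -EFinD.
have [p0 [_ [_ [_ [_ [_ pG]]]]]] := pS.
have [[a Aa]|nA] := pselect (A !=set0); last first.
  have -> : A = set0 by apply/seteqP; split => // x Ax; apply: nA; exists x.
  have [_ [_ [-> _]]] := pS.
  by rewrite lee_fin addr_ge0// ltW.
have cov x : A x -> exists2 n, b n x & (phi (closure (b n)) < (t + e)%:E)%E.
  move=> Ax; apply: dens_lt_base => //.
  by rewrite (le_lt_trans (At _ Ax))// ltrDl.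
pose F := [set b n | n in [set n | phi (closure (b n)) < (t + e)%:E]%E].
have [ob _ _] := hb.
apply: (@le_trans _ _ (phi (\bigcup_(G in F) G))).
  apply: supmeasure_le => // x Ax; have [n nx nt] := cov x Ax.
  by exists (b n) => //; exists n.
rewrite pG; first last.
- by move=> _ [n _ <-].
- by have [n _ nt] := cov a Aa; exists (b n), n.
apply: ge_ereal_sup => _ [_ [n nt <-] <-]; apply: ltW; apply: le_lt_trans nt.
by apply: supmeasure_le => //; exact: subset_closure.
Qed.

(** Singletons are compact, which gives one direction. For the other, with [m] the infimum of [f] on
    [K], the bound reads [phi K <= t / m] and [supmeasure_leP] applies, unless [m = 0] and the
    product vanishes. *)
Lemma eint_leP phi (f : E -> R) (t : R) : @supmeasure E R phi ->
  (forall x, 0 <= f x) -> 0 <= t ->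
  (eint f phi <= t%:E)%E <-> forall x, f x * dens phi x <= t.
Proof.
move=> pS f0 t0; split=> [ft x|ft].
  rewrite -lee_fin; apply: le_trans ft; apply: ereal_sup_ubound.
  exists [set x]; first exact: compact_set1.
  by rewrite image_set1 ereal_inf1 -densE// -EFinM mulrC.
apply: ge_ereal_sup => _ [K cK <-].
set m := ereal_inf _.
have [[a Ka]|nK] := pselect (K !=set0); last first.
  have -> : K = set0 by apply/seteqP; split => // x Kx; apply: nK; exists x.
  by have [_ [_ [-> _]]] := pS; rewrite mul0e lee_fin.
have m0 : (0 <= m)%E by apply: le_ereal_inf_tmp => _ [x _ <-]; rewrite lee_fin.
have mx x : K x -> (m <= (f x)%:E)%E.
  by move=> Kx; apply: ereal_inf_lbound; exists x.
have mfin : m \is a fin_num.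
  by rewrite ge0_fin_numE//; apply: le_lt_trans (mx a Ka) _; rewrite ltry.
move: m0 mx; rewrite -(fineK mfin) lee_fin => m0 mx.
have [m00|m00] := eqVneq (fine m) 0; last first.
  have mp : 0 < fine m by rewrite lt_neqAle eq_sym m00.
  rewrite -lee_pdivlMr// -EFinM; apply/supmeasure_leP => //.
    by rewrite divr_ge0.
  move=> x Kx; rewrite ler_pdivlMr// mulrC; apply: le_trans (ft x).
  by apply: ler_wpM2r; [exact: dens_ge0 | rewrite -lee_fin; exact: mx].
by rewrite m00 mule0 lee_fin.
Qed.

Lemma supmeasure_gtP phi A (t : R) : @supmeasure E R phi -> 0 <= t ->
  (t%:E < phi A)%E <-> exists2 x, A x & t < dens phi x.
Proof.
move=> pS t0; rewrite ltNge; split=> [/negP nt|[x Ax tx]].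
  apply: contrapT => nx; apply: nt; apply/supmeasure_leP => // x Ax.
  by rewrite leNgt; apply/negP => tx; apply: nx; exists x.
apply/negP => /supmeasure_leP => /(_ pS t0 x Ax).
by rewrite leNgt tx.
Qed.

End SupMeasureDensity.

(** * Sup-measures built from an upper semicontinuous density *)

Definition supm (E : topologicalType) (R : realType) (g : E -> R) (A : set E) :
    \bar R :=
  ereal_sup ([set 0%E] `|` [set (g x)%:E | x in A]).

Section SupMeasureOfDensity.
Context {E : topologicalType} {R : realType}.
Variable g : E -> R.
Hypotheses (hE : hausdorff_space E) (g0 : forall x, 0 <= g x).
Hypothesis g_usc : forall t : R, open [set x | g x < t].

Lemma supm_ge0 A : (0 <= supm g A)%E.
Proof. by apply: ereal_sup_ubound; left. Qed.

Lemma supm_ge A x : A x -> ((g x)%:E <= supm g A)%E.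
Proof. by move=> Ax; apply: ereal_sup_ubound; right; exists x. Qed.

Lemma supm_le A t : (0 <= t)%E -> (forall x, A x -> ((g x)%:E <= t)%E) ->
  (supm g A <= t)%E.
Proof. by move=> t0 At; apply: ge_ereal_sup => _ [->|[x Ax <-]] //; exact: At. Qed.

Lemma le_supm A B : A `<=` B -> (supm g A <= supm g B)%E.
Proof. by move=> AB; apply: supm_le; [exact: supm_ge0|move=> x /AB; exact: supm_ge]. Qed.

Lemma dens_supm x : dens (supm g) x = g x.
Proof.
rewrite /dens; suff -> : supm g [set x] = (g x)%:E by [].
apply/le_anti/andP; split; last exact: supm_ge.
by apply: supm_le => [|_ ->]; rewrite ?lee_fin.
Qed.

Lemma supm_compact_fin K : compact K -> (supm g K < +oo)%E.
Proof.
move=> cK.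
have [|s _ sK] := @compact_seq_cover E nat K setT
    (fun n => [set x | g x < n%:R]) cK (fun n _ => @g_usc n%:R).
  move=> x _; exists (Num.truncn (g x)).+1 => //=.
  exact: truncnS_gt.
apply: (@le_lt_trans _ _ (\max_(n <- s) n)%:R%:E); last by rewrite ltry.
apply: supm_le => [|x Kx]; first by rewrite lee_fin.
have [n ns /= /ltW gn] := sK x Kx.
by rewrite lee_fin (le_trans gn)// ler_nat leq_bigmax_seq.
Qed.

Lemma supmeasure_supm : supmeasure (supm g).
Proof.
split; first exact: supm_ge0.
split; first exact: supm_compact_fin.
split.
  (* The 0 adjoined in [supm] makes the supremum over the empty set 0 instead of [-oo]. *)
  by apply/le_anti/andP; split; [exact: supm_le|exact: supm_ge0].
split; first exact: le_supm.
split.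
  move=> A B Amono AB.
  have -> : supm g B = ereal_sup (range (fun n => supm g (A n))).
    apply/le_anti/andP; split.
      apply: supm_le.
        apply: le_trans (ereal_sup_ubound _); last by exists 0%N.
        exact: supm_ge0.
      rewrite -AB => x [n _ Ax]; apply: le_trans (ereal_sup_ubound _).
        exact: supm_ge Ax.
      by exists n.
    apply: ge_ereal_sup => _ [n _ <-]; apply: le_supm => x Ax.
    by rewrite -AB; exists n.
  apply: ereal_nondecreasing_cvgn => n m nm; apply: le_supm; exact: Amono.
split.
  move=> K L cK Kmono KL.
  have -> : supm g L = ereal_inf (range (fun n => supm g (K n))).
    apply/le_anti/andP; split.
      apply: le_ereal_inf_tmp => _ [n _ <-]; apply: le_supm.
      by rewrite -KL => x; apply.
    have Lfin : supm g L \is a fin_num.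
      rewrite ge0_fin_numE ?supm_ge0//.
      apply: le_lt_trans (supm_compact_fin (cK 0%N)).
      by apply: le_supm; rewrite -KL => x; apply.
    apply/lee_addgt0Pr => e e0; rewrite -(fineK Lfin) -EFinD.
    set r := _ + e.
    have Lr x : L x -> g x < r.
      move=> Lx; rewrite -lte_fin EFinD fineK// (le_lt_trans (supm_ge Lx))//.
      by rewrite lteDl.
    have r0 : 0 <= r by apply: addr_ge0; [rewrite fine_ge0 ?supm_ge0 | exact: ltW].
    (* Since [g < r] on [L], the open set where [g < r] and the complements of the [K n] cover
       [K 0]. By monotonicity, a finite subcover forces [g < r] on [K N] for the largest index [N]
       used. *)
    have [||s _ sK] := @compact_seq_cover E nat (K 0%N) setT
      (fun n => [set x | g x < r] `|` ~` K n) (cK 0%N).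
    - move=> n _; apply: openU; first exact: g_usc.
      by rewrite openC; apply: compact_closed.
    - move=> x _; have [Lx|nLx] := pselect (L x).
        by exists 0%N => //; left; exact: Lr.
      move: nLx; rewrite -KL => /existsNP[n /not_implyP[_ nK]].
      by exists n => //; right.
    pose N := (\max_(n <- s) n)%N.
    apply: (@le_trans _ _ (supm g (K N))).
      by apply: ereal_inf_lbound; exists N.
    apply: supm_le; first by rewrite lee_fin.
    move=> x KNx; rewrite lee_fin ltW//.
    have [n ns [//|]] := sK x (Kmono _ _ (leq0n N) _ KNx).
    by case; apply: Kmono KNx; exact: leq_bigmax_seq.
  by apply: ereal_nonincreasing_cvgn => n m nm; apply: le_supm; exact: Kmono.
move=> F [G0 FG0] _; apply/le_anti/andP; split.
  apply: supm_le.
    apply: le_trans (ereal_sup_ubound _); last by exists G0.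
    exact: supm_ge0.
  move=> x [G FG Gx]; apply: le_trans (supm_ge Gx) (ereal_sup_ubound _).
  by exists G.
by apply: ge_ereal_sup => _ [G FG <-]; apply: le_supm => x Gx; exists G.
Qed.

End SupMeasureOfDensity.

(** * The Borel sigma-algebra of the sup-vague topology *)

Section SigmaAlgebraOn.
Variables (T : Type) (D : set T) (S : set (set T)).
Hypothesis sS : sigma_algebra D S.

(** Events are cut down to [D] because [sv_borel] is a sigma-algebra on the sup-measures only, with
    complements taken inside them. *)
Definition sets_on (P : T -> Prop) : set T := [set x | D x /\ P x].

Lemma sigma_bigcup_count (I : countType) (Q : set I) (F : I -> set T) :
  (forall i, Q i -> S (F i)) -> S (\bigcup_(i in Q) F i).
Proof.
move=> SF; have [S0 _ SU] := sS.
pose A n := \bigcup_(i in [set i | Q i /\ pickle i = n]) F i.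
have -> : \bigcup_(i in Q) F i = \bigcup_n A n.
  apply/seteqP; split=> x.
    by move=> [i Qi Fx]; exists (pickle i) => //; exists i.
  by move=> [n _ [i [Qi _] Fx]]; exists i.
apply: SU => n.
have [[i [Qi ni]]|ni] := pselect (exists i, Q i /\ pickle i = n); last first.
  suff -> : A n = set0 by [].
  by apply/seteqP; split => // x [i Hi _]; apply: ni; exists i.
suff -> : A n = F i by apply: SF.
apply/seteqP; split => x; last by exists i.
by move=> [j [_]]; rewrite -ni => /(pcan_inj pickleK) ->.
Qed.

Lemma sets_on_not P : S (sets_on P) -> S (sets_on (fun x => ~ P x)).
Proof.
have [_ SD _] := sS => /SD; congr S; apply/seteqP; split => x.
  by move=> [Dx nP]; split => // Px; apply: nP.
by move=> [Dx nP]; split => // -[].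
Qed.

Lemma sets_on_ex (I : countType) (Q : set I) (P : I -> T -> Prop) :
  (forall i, Q i -> S (sets_on (P i))) ->
  S (sets_on (fun x => exists2 i, Q i & P i x)).
Proof.
move=> /sigma_bigcup_count; congr S; apply/seteqP; split => x.
  by move=> [i Qi [Dx Px]]; split => //; exists i.
by move=> [Dx [i Qi Px]]; exists i.
Qed.

Lemma sets_on_all (I : countType) (Q : set I) (P : I -> T -> Prop) :
  (forall i, Q i -> S (sets_on (P i))) ->
  S (sets_on (fun x => forall i, Q i -> P i x)).
Proof.
move=> SP; have /sets_on_not : S (sets_on (fun x => exists2 i, Q i & ~ P i x)).
  by apply: sets_on_ex => i /SP /sets_on_not.
congr S; apply/seteqP; split => x [Dx].
  move=> nP; split => // i Qi; apply: contrapT => nPi; apply: nP; by exists i.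
by move=> HP; split => // -[i /HP].
Qed.

Lemma sets_on_cst (P : Prop) : S (sets_on (fun=> P)).
Proof.
have [S0 SD _] := sS; have [HP|nP] := pselect P.
  suff -> : sets_on (fun=> P) = D `\` set0 by exact: SD.
  by apply/seteqP; split => x [Dx _]; split.
suff -> : sets_on (fun=> P) = set0 by [].
by rewrite -subset0 => x [].
Qed.

Lemma sets_on_ext P P' : (forall x, D x -> P x <-> P' x) ->
  sets_on P = sets_on P'.
Proof.
by move=> PP; apply/seteqP; split=> x [Dx Px]; split => //; apply/PP.
Qed.

End SigmaAlgebraOn.

(** * Functions of [USC] and finite rational codes above them *)

Section UpperSemicontinuous.
Context {E : topologicalType} {R : realType}.
Hypothesis hE : hausdorff_space E.
Implicit Types f g : E -> R.

Definition supp f := closure [set x | f x != 0].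

Lemma supp0 f x : ~ supp f x -> f x = 0.
Proof.
by move=> nfx; apply/eqP/negPn/negP => fx; apply: nfx; exact: subset_closure.
Qed.

Lemma USC_ge0 f : USC f -> forall x, 0 <= f x. Proof. by case. Qed.

Lemma USC_fmax f g : USC f -> USC g -> USC (fmax f g).
Proof.
move=> [f0 [M fM] fo fc] [g0 [N gN] go gc]; split.
- by move=> x; rewrite /fmax le_max f0.
- by exists (Num.max M N) => x; rewrite ge_max !le_max fM gN orbT.
- move=> t; have -> : [set x | fmax f g x < t] = [set x | f x < t] `&` [set x | g x < t].
    by apply/seteqP; split => x /=; rewrite /fmax gt_max => /andP.
  exact: openI.
- apply: (subclosed_compact _ (compactU fc gc)); first exact: closed_closure.
  rewrite -closureU; apply: closure_subset => x /=; rewrite /fmax => fgx.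
  have [fx|fx] := eqVneq (f x) 0; [right|by left].
  by move: fgx; rewrite fx max_r.
Qed.

Lemma USC_scale c f : 0 < c -> USC f -> USC (fun x => c * f x).
Proof.
move=> c0 [f0 [M fM] fo fc]; split.
- by move=> x; rewrite mulr_ge0// ltW.
- by exists (c * M) => x; rewrite ler_pM2l.
- move=> t; have -> : [set x | c * f x < t] = [set x | f x < t / c]; last exact: fo.
  by apply/seteqP; split => x /=; rewrite ltr_pdivlMr// mulrC.
- have -> : [set x | c * f x != 0] = [set x | f x != 0]; last exact: fc.
  by apply/seteqP; split => x /=; rewrite mulf_eq0 (gt_eqF c0).
Qed.

Definition cap_fun (u : R) (K : set E) : E -> R := fun x => u * \1_K x.

Lemma USC_cap_fun u K : 0 <= u -> compact K -> USC (cap_fun u K).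
Proof.
move=> u0 cK; have clK : closed K by exact: compact_closed.
rewrite /cap_fun; split.
- by move=> x; rewrite mulr_ge0.
- by exists u => x; rewrite indicE; case: (_ \in _); rewrite ?mulr1 ?mulr0.
- move=> t; have [t0|t0] := leP t 0.
    suff -> : [set x | u * \1_K x < t] = set0 by exact: open0.
    rewrite -subset0 => x /=; rewrite ltNge => /negP; apply.
    by rewrite (le_trans t0)// mulr_ge0.
  have [ut|tu] := ltP u t.
    suff -> : [set x | u * \1_K x < t] = setT by exact: openT.
    rewrite -subTset => x _ /=; rewrite indicE.
    by case: (_ \in _); rewrite ?mulr1 ?mulr0.
  suff -> : [set x | u * \1_K x < t] = ~` K by rewrite openC.
  apply/seteqP; split => x /=; rewrite indicE.
    by move=> + Kx; rewrite mem_set// mulr1 ltNge tu.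
  by move=> nKx; rewrite memNset// mulr0.
- apply: (subclosed_compact _ cK); first exact: closed_closure.
  rewrite [X in _ `<=` X](closure_id K).1//; apply: closure_subset => x /=.
  by apply: contraNP => nKx; rewrite indicE memNset// mulr0.
Qed.

Lemma USC0 : USC (fun _ : E => 0 : R).
Proof.
split => //; first by exists 0.
  move=> t; have [t0|t0] := ltP 0 t.
    by rewrite (_ : mkset _ = setT); [exact: openT | apply/seteqP; split].
  by rewrite (_ : mkset _ = set0); [exact: open0 | apply/seteqP; split].
rewrite (_ : mkset _ = set0); first by rewrite closure0; exact: compact0.
by apply/seteqP; split => // x /=; rewrite eqxx.
Qed.

Definition fmaxs (s : seq (E -> R)) : E -> R := foldr (fun f g => fmax f g) (fun=> 0) s.

Lemma USC_fmaxs s : (forall f, f \in s -> USC f) -> USC (fmaxs s).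
Proof.
elim: s => [_|f s IH fs] /=; first exact: USC0.
apply: USC_fmax; first by apply: fs; rewrite mem_head.
by apply: IH => g gs; apply: fs; rewrite in_cons gs orbT.
Qed.

Lemma fmaxC f g : fmax f g = fmax g f.
Proof. by apply/funext => x; rewrite /fmax maxC. Qed.

Lemma fmaxA f g h : fmax f (fmax g h) = fmax (fmax f g) h.
Proof. by apply/funext => x; rewrite /fmax maxA. Qed.

Lemma fmax_r f g : (forall x, f x <= g x) -> fmax f g = g.
Proof. by move=> fg; apply/funext => x; rewrite /fmax max_r. Qed.

Lemma fmaxs_cat s t : fmaxs (s ++ t) = fmax (fmaxs s) (fmaxs t).
Proof.
elim: s => [|f s IH] /=; last by rewrite IH fmaxA.
rewrite fmax_r// => x; elim: t => //= f t IH.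
by rewrite /fmax le_max IH orbT.
Qed.

Section Codes.
Variable b : nat -> set E.

(* [s] lists pairs (n, q) standing for the functions q 1_{closure (b n)};
   [f] lies strictly below their maximum, witnessed on the open sets [b n]. *)
Definition prec f (s : seq (nat * rat)) :=
  forall x, supp f x -> exists2 c, c \in s & b c.1 x /\ f x < ratr c.2.

(** The sets where [f < q] are open and the closed support is compact, so codes chosen point by
    point reduce to a finite list. *)
Lemma prec_cover f (Q : set (nat * rat)) : nbhs_base b -> USC f ->
  (forall x, supp f x -> exists2 c, Q c & b c.1 x /\ f x < ratr c.2) ->
  exists2 s, (forall c, c \in s -> Q c) & prec f s.
Proof.
move=> [bo _ _] [_ _ fo fc].
apply: (@compact_seq_cover _ _ (supp f) Q
  (fun c => b c.1 `&` [set x | f x < ratr c.2])) => //.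
by move=> c _; apply: openI.
Qed.

Lemma prec_mul_lt1 f (g : E -> R) s : USC f -> (forall x, 0 <= g x) -> prec f s ->
  (forall c x, c \in s -> b c.1 x -> ratr c.2 * g x <= 1) ->
  forall x, f x * g x < 1.
Proof.
move=> fU g0 fs sg x; have [fx|/supp0->] := pselect (supp f x); last first.
  by rewrite mul0r.
have [c cs [bx fc]] := fs x fx.
have [->|gx] := eqVneq (g x) 0; first by rewrite mulr0.
apply: lt_le_trans (sg c x cs bx); rewrite ltr_pM2r//.
by rewrite lt_neqAle eq_sym gx g0.
Qed.

Lemma exists_rat_mul_lt1 (a d : R) : 0 <= a -> 0 <= d -> a * d < 1 ->
  exists q : rat, [/\ a < ratr q, 0 < (ratr q : R) & d < (ratr q)^-1].
Proof.
move=> a0 d0 ad.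
(* The rational is sought between [a] and [v = 1 / d]; if [d = 0] any [v] above [a] will do. *)
have [v [av dv]] : exists v, a < v /\ v * d <= 1.
  have [->|dn] := eqVneq d 0; first by exists (a + 1); rewrite mulr0 ltrDl.
  exists d^-1; rewrite mulVf//; split => //.
  by rewrite -[d^-1]mul1r ltr_pdivlMr// lt_neqAle eq_sym dn.
have [q] := rat_in_itvoo av; rewrite in_itv/= => /andP[aq qv].
have q0 : 0 < (ratr q : R) by exact: le_lt_trans aq.
exists q; split => //; rewrite -[_^-1]mul1r ltr_pdivlMr//.
have [->|dn] := eqVneq d 0; first by rewrite mul0r.
by apply: lt_le_trans dv; rewrite mulrC ltr_pM2r// lt_neqAle eq_sym dn.
Qed.

Definition scale (c : R) f : E -> R := fun x => c * f x.

(** Compactness handles only strict bounds; this writes a non-strict one as a countable conjunction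
    of strict bounds by 1. *)
Lemma le_all_lt1P f (g : E -> R) (t : R) : 0 < t ->
  (forall x, f x * g x <= t) <->
  forall k : nat, forall x, scale (t + k.+1%:R^-1)^-1 f x * g x < 1.
Proof.
move=> t0; split=> [fg k x|fg x].
  rewrite /scale -mulrA mulrC ltr_pdivrMr; last by rewrite addr_gt0.
  by rewrite mul1r (le_lt_trans (fg x))// ltrDl.
apply/ler_addgt0Pr => e e0.
have [k ke] : exists k : nat, k.+1%:R^-1 < e.
  exists (Num.truncn e^-1); rewrite invf_plt ?posrE//; exact: truncnS_gt.
have /ltW := fg k x; rewrite /scale -mulrA mulrC ler_pdivrMr; last by rewrite addr_gt0.
by rewrite mul1r => /le_trans; apply; rewrite lerD2l ltW.
Qed.

End Codes.

End UpperSemicontinuous.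

(** * Extremal integrals generate the Borel sigma-algebra *)

Section SupVagueBorel.
Context {E : topologicalType} {R : realType} {b : nat -> set E}.
Hypotheses (hE : hausdorff_space E) (hb : nbhs_base b).
Local Notation SM := (@supmeasure E R).
Local Notation K c := (closure (b c)).

(** The quantifier over points becomes one over countably many finite lists, each of which
    constrains finitely many values [phi (K n)]; this is what makes the condition measurable. *)
Lemma mul_dens_lt1P phi f : SM phi -> USC f ->
  (forall x, f x * dens phi x < 1) <->
  exists2 s, prec b f s & forall c, c \in s ->
    0 < (ratr c.2 : R) /\ (phi (K c.1) < ((ratr c.2)^-1)%:E)%E.
Proof.
move=> pS fU; split=> [fd|[s fs sp]].
  have [x fx|s sQ fs] := @prec_cover E R b f (fun c =>
      0 < (ratr c.2 : R) /\ (phi (K c.1) < ((ratr c.2)^-1)%:E)%E) hb fU.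
    have [q [fq q0 dq]] := exists_rat_mul_lt1 (USC_ge0 fU x) (dens_ge0 x pS) (fd x).
    by have [n bx pn] := dens_lt_base hE hb pS dq; exists (n, q).
  by exists s.
apply: prec_mul_lt1 fs _ => //; first by move=> x; exact: dens_ge0.
move=> c x /sp[c0 pc] bx.
rewrite mulrC -ler_pdivlMr// mul1r -lee_fin; apply: le_trans (ltW pc).
by apply: dens_le => //; exact: subset_closure.
Qed.

Lemma sets_on_eint_le (S : set (set (set E -> \bar R))) f (t : R) :
  sigma_algebra SM S ->
  (forall L r, compact L -> S (sets_on SM (fun phi => (phi L < r%:E)%E))) ->
  USC f -> 0 < t -> S (sets_on SM (fun phi => (eint f phi <= t%:E)%E)).
Proof.
move=> sS SK fU t0.
rewrite (@sets_on_ext _ _ _ (fun phi => forall k : nat, setT k ->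
  exists2 s, prec b (scale (t + k.+1%:R^-1)^-1 f) s &
    forall c, [set c | c \in s] c ->
    0 < (ratr c.2 : R) /\ (phi (K c.1) < ((ratr c.2)^-1)%:E)%E)); last first.
  move=> phi pS.
  have f0 := USC_ge0 fU.
  have fkU k : USC (scale (t + k.+1%:R^-1)^-1 f).
    by apply: USC_scale => //; rewrite invr_gt0 addr_gt0.
  split.
    move=> /(eint_leP hE hb pS f0 (ltW t0)) /(le_all_lt1P _ _ t0) H k _.
    exact/mul_dens_lt1P.
  move=> H; apply/(eint_leP hE hb pS f0 (ltW t0))/(le_all_lt1P _ _ t0) => k.
  by apply/mul_dens_lt1P => //; exact: H.
apply: sets_on_all => // k _; apply: sets_on_ex => // s _.
apply: sets_on_all => // c _.
have [c0|c0] := pselect (0 < (ratr c.2 : R)).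
  rewrite (@sets_on_ext _ _ _ (fun phi => phi (K c.1) < ((ratr c.2)^-1)%:E)%E).
    by apply: SK; have [_ + _] := hb.
  by move=> phi _; split => [[]|].
by rewrite (@sets_on_ext _ _ _ (fun=> False)); [exact: sets_on_cst|move=> ? _; split => // -[]].
Qed.

Lemma sv_borel_lt L r : compact L ->
  sv_borel (sets_on SM (fun phi => (phi L < r%:E)%E)).
Proof.
move=> cL; apply: sub_sigma_algebra.
exists [set [set phi | (phi L < r%:E)%E]]; split; last by rewrite bigcup_set1.
move=> _ ->; exists [:: [set phi | (phi L < r%:E)%E]]; split; last first.
  by rewrite big_seq1.
by move=> B; rewrite inE => /eqP ->; left; exists L, r.
Qed.

Lemma sv_borel_eint_le f t : USC f -> 0 < t ->
  sv_borel (sets_on SM (fun phi => (eint f phi <= t%:E)%E)).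
Proof.
move=> fU t0; apply: sets_on_eint_le => //; first exact: smallest_sigma_algebra.
exact: sv_borel_lt.
Qed.

(** The strict inequality survives the supremum because, by compactness, finitely many rationals
    below [t] dominate the density on [L]. *)
Lemma supmeasure_lt_compact phi L (t : R) : SM phi -> compact L -> 0 < t ->
  (forall x, L x -> dens phi x < t) -> (phi L < t%:E)%E.
Proof.
move=> pS cL t0 Lt.
have [bo _ _] := hb.
have [|x Lx|s sQ sL] := @compact_seq_cover E (nat * rat)%type L
  (fun c => (ratr c.2 : R) < t /\ (phi (K c.1) < (ratr c.2)%:E)%E)
  (fun c => b c.1) cL.
- by move=> c _; exact: bo.
- have [q] := rat_in_itvoo (Lt x Lx); rewrite in_itv/= => /andP[dq qt].
  by have [n bx nq] := dens_lt_base hE hb pS dq; exists (n, q).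
apply: (@le_lt_trans _ _ (\big[Num.max/0]_(c <- s) (ratr c.2 : R))%:E); last first.
  by rewrite lte_fin big_seq; apply: bigmax_lt => // c /sQ[].
have m0 : 0 <= \big[Num.max/0]_(c <- s) (ratr c.2 : R).
  by rewrite bigmax_idl le_max lexx.
apply/(supmeasure_leP hE hb) => // x Lx.
have [c cs bx] := sL x Lx; have [_ pc] := sQ c cs.
apply: (@le_trans _ _ (ratr c.2)); last first.
  exact: (@le_bigmax_seq _ _ _ _ _ _ xpredT (fun c => ratr c.2 : R)) cs _.
rewrite -lee_fin; apply: le_trans (ltW pc).
by apply: dens_le => //; exact: subset_closure.
Qed.

(** The boolean demands either the inequality or its failure, so the same codes approximate both
    kinds of subbasic sets. *)
Definition code_event (c : nat * rat * bool) (phi : set E -> \bar R) : Prop :=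
  (phi (K c.1.1) < (ratr c.1.2)%:E)%E = c.2.

(** A bound on a compact set follows from bounds on a finite cover by base sets. A lower bound on an
    open set is witnessed at one point, hence on the closure of a base set around it contained in
    the open set. *)
Lemma sv_subbase_code B phi : sv_subbase B -> SM phi -> B phi ->
  exists2 s : seq (nat * rat * bool), (forall c, c \in s -> code_event c phi) &
    forall psi, SM psi -> (forall c, c \in s -> code_event c psi) -> B psi.
Proof.
have [bo _ xb] := hb.
move=> [[L [t [cL ->]]]|[G [t [oG ->]]]] pS /= Bphi.
  have t0 : 0 < t.
    by have [p0 _] := pS; rewrite -lte_fin; apply: le_lt_trans (p0 L) Bphi.
  have [|x Lx|s sQ sL] := @compact_seq_cover E (nat * rat)%type L
    (fun c => (ratr c.2 : R) < t /\ (phi (K c.1) < (ratr c.2)%:E)%E)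
    (fun c => b c.1) cL.
  - by move=> c _; exact: bo.
  - have dt : dens phi x < t by rewrite -lte_fin; apply: le_lt_trans Bphi; exact: dens_le.
    have [q] := rat_in_itvoo dt; rewrite in_itv/= => /andP[dq qt].
    by have [n bx nq] := dens_lt_base hE hb pS dq; exists (n, q).
  exists [seq (c, true) | c <- s]; first by move=> _ /mapP[c /sQ[_ ?] ->].
  move=> psi qS sc; apply: supmeasure_lt_compact => // x Lx.
  have [c cs bx] := sL x Lx.
  have := sc _ (map_f (fun c => (c, true)) cs); rewrite /code_event/= => pc.
  have [ct _] := sQ c cs; apply: lt_trans ct.
  rewrite -lte_fin; apply: le_lt_trans pc.
  by apply: dens_le => //; exact: subset_closure.
(* For negative [t] the condition holds for every sup-measure, and the empty list suffices. *)
have [t0|t0] := ltP t 0.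
  exists [::] => // psi [p0 _] _; apply: lt_le_trans (p0 G).
  by rewrite lte_fin.
have [x Gx tx] := (supmeasure_gtP hE hb G pS t0).1 Bphi.
have [n bx nG] := xb x G (open_nbhs_nbhs (conj oG Gx)).
have [q] := rat_in_itvoo tx; rewrite in_itv/= => /andP[tq qd].
exists [:: (n, q, false)].
  move=> c; rewrite inE => /eqP ->; rewrite /code_event/=; apply/negbTE.
  rewrite -leNgt; apply: le_trans (dens_le pS (subset_closure bx)).
  by rewrite lee_fin ltW.
move=> psi qS /(_ _ (mem_head _ _)); rewrite /code_event/= => /negbT.
rewrite -leNgt => qn; apply: (@lt_le_trans _ _ (ratr q)%:E).
  by rewrite lte_fin.
by apply: le_trans qn _; exact: supmeasure_le.
Qed.

Lemma sv_borel_sub (S : set (set (set E -> \bar R))) :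
  sigma_algebra SM S ->
  (forall f, USC f -> S (sets_on SM (fun phi => (eint f phi <= 1%:E)%E))) ->
  @sv_borel E R `<=` S.
Proof.
move=> sS Sf.
have Sle L r : compact L -> 0 < r -> S (sets_on SM (fun phi => phi L <= r%:E)%E).
  move=> cL r0.
  (* For [f = r^-1 1_L] the condition [eint f phi <= 1] means [phi L <= r]. *)
  have fU : USC (cap_fun r^-1 L) by apply: USC_cap_fun => //; rewrite invr_ge0 ltW.
  have := Sf _ fU; congr S; apply: sets_on_ext => phi pS.
  split.
    move=> /(eint_leP hE hb pS (USC_ge0 fU) ler01) H.
    apply/(supmeasure_leP hE hb) => //; first exact: ltW.
    move=> x Lx; have := H x; rewrite /cap_fun indicE mem_set// mulr1 mulrC.
    by rewrite ler_pdivrMr// mul1r.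
  move=> /(supmeasure_leP hE hb _ pS (ltW r0)) H.
  apply/(eint_leP hE hb pS (USC_ge0 fU) ler01) => x.
  rewrite /cap_fun indicE; have [Lx|nLx] := pselect (L x).
    by rewrite mem_set// mulr1 mulrC ler_pdivrMr// mul1r; exact: H.
  by rewrite memNset// mulr0 mul0r.
have Slt L r : compact L -> S (sets_on SM (fun phi => phi L < r%:E)%E).
  move=> cL.
  rewrite (@sets_on_ext _ _ _ (fun phi => exists2 q : rat,
    [set q | 0 < (ratr q : R) /\ (ratr q : R) < r] q & (phi L <= (ratr q)%:E)%E)).
    by apply: sets_on_ex => // q [q0 qr]; exact: Sle.
  move=> phi [p0 [pK _]]; split=> [Lr|[q [q0 qr] /= Lq]]; last first.
    by apply: le_lt_trans Lq _; rewrite lte_fin.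
  have Lf : phi L \is a fin_num by rewrite ge0_fin_numE// pK.
  move: (p0 L) Lr; rewrite -(fineK Lf) lte_fin lee_fin => L0 Lr.
  have [q] := rat_in_itvoo Lr; rewrite in_itv/= => /andP[Lq qr].
  by exists q => /=; [split => //; exact: le_lt_trans Lq|rewrite lee_fin ltW].
apply: smallest_sub => // U [F [FV ->]].
(* An open set is an arbitrary union, but it is also the union of the code neighbourhoods it
   contains, and there are only countably many lists of codes. *)
pose Q (s : seq (nat * rat * bool)) := forall psi, SM psi ->
  (forall c, c \in s -> code_event c psi) -> (\bigcup_(V in F) V) psi.
have -> : SM `&` \bigcup_(V in F) V = sets_on SM (fun phi =>
    exists2 s, Q s & forall c, [set c | c \in s] c -> code_event c phi).
  apply/seteqP; split=> phi [pS].
    move=> [V FVV Vphi]; split => //.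
    suff [s sphi sV] : exists2 s : seq (nat * rat * bool), (forall c, c \in s -> code_event c phi) &
       forall psi, SM psi -> (forall c, c \in s -> code_event c psi) -> V psi.
      by exists s => // psi qS spsi; exists V => //; exact: sV.
    have [r [rB VE]] := FV V FVV.
    move: Vphi; rewrite VE => {V FVV VE}.
    elim: r rB => [_ _|B r IH rB]; first by exists [::] => // psi _ _; rewrite big_nil.
    rewrite big_cons => -[Bphi rphi].
    have [s1 s1p s1B] := sv_subbase_code (rB B (mem_head _ _)) pS Bphi.
    have [|s2 s2p s2B] := IH _ rphi.
      by move=> C Cr; apply: rB; rewrite in_cons Cr orbT.
    exists (s1 ++ s2); first by move=> c; rewrite mem_cat => /orP[/s1p|/s2p].
    move=> psi qS sc; split.
      by apply: s1B => // c cs; apply: sc; rewrite mem_cat cs.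
    by apply: s2B => // c cs; apply: sc; rewrite mem_cat cs orbT.
  by move=> [s Qs sp]; split => //; exact: Qs.
apply: sets_on_ex => // s _; apply: sets_on_all => // -[[n q] [|]] _.
  by apply: Slt; have [_ + _] := hb.
rewrite (@sets_on_ext _ _ _ (fun phi => ~ (phi (K n) < (ratr q)%:E)%E)).
  by apply: sets_on_not => //; apply: Slt; have [_ + _] := hb.
by move=> phi _; rewrite /code_event/=; split=> [->|/negP/negbTE].
Qed.

End SupVagueBorel.

(** * Completely monotone functionals *)

Section MaxDiff.
Context {E : topologicalType} {R : realType}.
Implicit Types (F G l : (E -> R) -> R) (f g h : E -> R).

Lemma maxdiff_fmax F g gs h :
  maxdiff (fun f => F (fmax f g)) gs h = maxdiff F gs (fmax h g).
Proof.
elim: gs h => //= g' gs IH h; rewrite !IH; congr (_ - maxdiff _ _ _).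
by rewrite -!fmaxA (fmaxC g).
Qed.

Lemma maxdiff_linear a F G gs h :
  maxdiff (fun f => a * F f + G f) gs h = a * maxdiff F gs h + maxdiff G gs h.
Proof. by elim: gs h => //= g gs IH h; rewrite !IH; ring. Qed.

(** Differences commute with translations by [fmax], so the head of the list can act on the
    functional first; inductions on the list then vary the functional. *)
Lemma maxdiff_cons F g gs h :
  maxdiff F (g :: gs) h = maxdiff (fun f => F f - F (fmax f g)) gs h.
Proof.
have -> : (fun f => F f - F (fmax f g)) = (fun f => -1 * F (fmax f g) + F f).
  by apply/funext => f; ring.
by rewrite maxdiff_linear maxdiff_fmax /=; ring.
Qed.

Lemma maxdiff_cst c g gs h : maxdiff (fun=> c) (g :: gs) h = 0.
Proof.
elim: gs h g => [|g' gs IH] h g; rewrite /= ?subrr//.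
by rewrite -!/(maxdiff _ (_ :: _) _) !IH subrr.
Qed.

Lemma maxdiff_cvg (Fn : nat -> (E -> R) -> R) F gs h :
  (forall f, Fn n f @[n --> \oo] --> F f) ->
  maxdiff (Fn n) gs h @[n --> \oo] --> maxdiff F gs h.
Proof. by move=> cF; elim: gs h => //= g gs IH h; exact: cvgB. Qed.

Section CompletelyMonotone.
Variable C : set (E -> R).
Hypothesis Cmax : forall f g, C f -> C g -> C (fmax f g).

(** The empty list is allowed, so such an [F] is non-negative on [C]. The class [C] is a parameter
    in order to treat [l H - l] on the functions below [H]. *)
Definition max_completely_monotone F := forall gs h,
  (forall g, g \in gs -> C g) -> C h -> 0 <= maxdiff F gs h.
Local Notation cmon := max_completely_monotone.

Lemma cmon_linear a F G : 0 <= a -> cmon F -> cmon G ->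
  cmon (fun f => a * F f + G f).
Proof.
by move=> a0 mF mG gs h Cgs Ch; rewrite maxdiff_linear addr_ge0 ?mulr_ge0 ?mF ?mG.
Qed.

Lemma cmon_cst c : 0 <= c -> cmon (fun=> c).
Proof. by move=> c0 [|g gs] h _ _ //; rewrite maxdiff_cst. Qed.

Lemma cmon_diff F g : C g -> cmon F -> cmon (fun f => F f - F (fmax f g)).
Proof.
move=> Cg mF gs h Cgs Ch; rewrite -maxdiff_cons; apply: mF => // g'.
by rewrite inE => /predU1P[->|/Cgs].
Qed.

Lemma cmon_fmax F g : C g -> cmon F -> cmon (fun f => F (fmax f g)).
Proof. by move=> Cg mF gs h Cgs Ch; rewrite maxdiff_fmax; apply: mF => //; exact: Cmax. Qed.

(* Leibniz rule: F G - F' G' = (F - F') G + F' (G - G') *)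
Lemma cmonM F G : cmon F -> cmon G -> cmon (fun f => F f * G f).
Proof.
move=> mF mG gs; elim: gs F G mF mG => [|g gs IH] F G mF mG h Cgs Ch.
  by rewrite /= mulr_ge0// ?(mF [::]) ?(mG [::]).
have Cg : C g by apply: Cgs; rewrite mem_head.
have {}Cgs g' : g' \in gs -> C g' by move=> g'gs; apply: Cgs; rewrite inE g'gs orbT.
rewrite maxdiff_cons.
have -> : (fun f => F f * G f - F (fmax f g) * G (fmax f g)) =
    (fun f => 1 * ((F f - F (fmax f g)) * G f) + F (fmax f g) * (G f - G (fmax f g))).
  by apply/funext => f; ring.
rewrite maxdiff_linear mul1r addr_ge0// IH//; do ?exact: cmon_diff.
exact: cmon_fmax.
Qed.

Lemma cmonX F k : cmon F -> cmon (fun f => F f ^+ k).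
Proof.
move=> mF; elim: k => [|k IH]; first exact: cmon_cst.
by under eq_fun do rewrite exprS; exact: cmonM.
Qed.

(** The partial sums of the exponential series are combinations of powers with non-negative
    coefficients, and max-differences pass to pointwise limits. *)
Lemma cmon_expR F : cmon F -> cmon (fun f => expR (F f)).
Proof.
move=> mF gs h Cgs Ch.
have cvgF : maxdiff (fun f => series (exp_coeff (F f)) n) gs h @[n --> \oo] -->
    maxdiff (fun f => expR (F f)) gs h.
  by apply: maxdiff_cvg => f; exact: is_cvg_series_exp_coeff.
rewrite -(cvg_lim (@Rhausdorff R) cvgF); apply: limr_ge.
  by apply/cvg_ex; eexists; exact: cvgF.
apply: nearW => n.
suff : cmon (fun f => series (exp_coeff (F f)) n) by exact.
elim: n => [|n IH].
  by under eq_fun do rewrite /series/= big_geq//; exact: cmon_cst.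
have -> : (fun f => series (exp_coeff (F f)) n.+1) =
  (fun f => (n`!%:R)^-1 * F f ^+ n + series (exp_coeff (F f)) n).
  apply/funext => f; rewrite /series/= big_nat_recr//= addrC /exp_coeff/=.
  by rewrite mulrC.
by apply: cmon_linear => //; exact: cmonX.
Qed.

End CompletelyMonotone.

Lemma mca_le l f g : max_completely_alternating l -> USC f -> USC g ->
  (forall x, f x <= g x) -> l f <= l g.
Proof.
move=> al fU gU fg; have := al [:: g] f isT _ fU; rewrite /= fmax_r// subr_le0.
by apply=> g'; rewrite inE => /eqP ->.
Qed.

(* Below a fixed H, [l H - l] is completely monotone, hence so is
   [exp (- l) = exp (- l H) * exp (l H - l)]. *)
Lemma cmon_expRN l : max_completely_alternating l ->
  max_completely_monotone (@USC E R) (fun f => expR (- l f)).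
Proof.
move=> al gs h gsU hU.
(* [H] dominates [h] and all of [gs], so every maximum that occurs in [maxdiff] stays in the class
   [C] of functions below [H]. *)
pose H := fmaxs (h :: gs).
have HU : USC H.
  by apply: USC_fmaxs => f; rewrite inE => /predU1P[->|/gsU].
pose C f := USC f /\ forall x, f x <= H x.
have Hge f x : f \in h :: gs -> f x <= H x.
  rewrite /H; elim: (h :: gs) => //= g s IH; rewrite inE /fmax le_max.
  by move=> /predU1P[->|/IH->]; rewrite ?lexx// orbT.
have Cmax f g : C f -> C g -> C (fmax f g).
  move=> [fU fH] [gU gH]; split; first exact: USC_fmax.
  by move=> x; rewrite /fmax ge_max fH gH.
have mH : max_completely_monotone C (fun f => -1 * l f + l H).
  move=> [|g s] f Cs [fU fH].
    by rewrite /= mulN1r addrC subr_ge0; apply: mca_le.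
  rewrite maxdiff_linear maxdiff_cst addr0 mulN1r oppr_ge0.
  by apply: al => // g' /Cs[].
have -> : (fun f => expR (- l f)) =
    (fun f => expR (- l H) * expR (-1 * l f + l H)).
  by apply/funext => f; rewrite -expRD; congr expR; ring.
apply: (@cmonM C Cmax (fun=> expR (- l H))).
- by apply: cmon_cst; exact: expR_ge0.
- exact: cmon_expR.
- by move=> g ggs; split; [exact: gsU|move=> x; apply: Hge; rewrite inE ggs orbT].
- by split => // x; apply: Hge; rewrite mem_head.
Qed.

End MaxDiff.

(** * Events with prescribed joint probabilities *)

Section EventsOfMaxDiff.
Context {E : topologicalType} {R : realType}.
Variables (Phi : (E -> R) -> R) (F : nat -> E -> R).
Hypothesis Phi_cmon : max_completely_monotone (@USC E R) Phi.
Hypothesis Phi0 : Phi (fun=> 0) = 1.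
Hypothesis FU : forall n, USC (F n).

(* A word lists the outcomes of the events number [size w - 1], ..., 0, most
   recent first; [wgt w] is the prescribed probability of these outcomes, and
   the words of a given length index a partition of [0, 1[ into intervals
   [lft w, lft w + wgt w[ that refines as the length grows. *)
Fixpoint ones (w : seq bool) : E -> R :=
  if w is v :: w' then if v then fmax (ones w') (F (size w')) else ones w'
  else fun=> 0.

Fixpoint zeros (w : seq bool) : seq (E -> R) :=
  if w is v :: w' then if v then zeros w' else F (size w') :: zeros w'
  else [::].

Definition wgt w := maxdiff Phi (zeros w) (ones w).

Fixpoint lft (w : seq bool) : R :=
  if w is v :: w' then if v then lft w' else lft w' + wgt (true :: w') else 0.

Fixpoint word n (u : R) : seq bool :=
  if n is n'.+1 then
    let w := word n' u in (u < lft w + wgt (true :: w)) :: w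
  else [::].

Lemma wgt_split w : wgt w = wgt (true :: w) + wgt (false :: w).
Proof. by rewrite /wgt /=; ring. Qed.

Lemma USC_ones w : USC (ones w).
Proof. by elim: w => [|[] w IH] //=; [exact: USC0 | exact: USC_fmax]. Qed.

Lemma USC_zeros w g : g \in zeros w -> USC g.
Proof. by elim: w => [|[] w IH] //=; rewrite inE => /predU1P[->|/IH]. Qed.

Lemma wgt_ge0 w : 0 <= wgt w.
Proof. by apply: Phi_cmon; [exact: USC_zeros | exact: USC_ones]. Qed.

Lemma lft_ge0 w : 0 <= lft w.
Proof. by elim: w => [|[] w IH] //=; rewrite addr_ge0 ?wgt_ge0. Qed.

Lemma lft_wgt_le1 w : lft w + wgt w <= 1.
Proof.
elim: w => [|[] w IH]; first by rewrite /wgt /= Phi0 add0r.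
  rewrite [lft _]/=; apply: le_trans IH; rewrite lerD2l (wgt_split w).
  by rewrite lerDl wgt_ge0.
by rewrite [lft _]/= -addrA -wgt_split.
Qed.

Lemma size_word n u : size (word n u) = n.
Proof. by elim: n => //= n ->. Qed.

(** By [wgt_split], the intervals of [true :: w] and [false :: w] cut that of [w] exactly at the
    threshold used by [word], with the [true] part on the left. *)
Lemma wordP n w u : 0 <= u < 1 -> size w = n ->
  word n u = w <-> lft w <= u < lft w + wgt w.
Proof.
move=> u01; elim: n w => [|n IH] [|v w] //=.
  by move=> _; rewrite /wgt /= Phi0 add0r.
move=> [sw]; have := wgt_split w; have := wgt_ge0 (true :: w).
have := wgt_ge0 (false :: w); have := IH w sw.
case: v => /= H w0 w1 ws.
  split=> [[u1 wE]|/andP[u0 u1]].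
    by move: u1; rewrite wE => ->; have /andP[-> _] := H.1 wE.
  have wE : word n u = w.
    by apply/H; rewrite u0/= (lt_le_trans u1)// lerD2l ws lerDl.
  by rewrite wE u1.
split=> [[+ wE]|/andP[u0 u1]].
  rewrite wE => /negbT; rewrite -leNgt => ->.
  by have /andP[_] := H.1 wE; rewrite ws addrA.
have wE : word n u = w.
  apply/H; rewrite (le_trans _ u0) ?lerDl//=.
  by rewrite ws addrA.
by rewrite wE ltNge u0.
Qed.

(** Outcome number [i] is the head of the word of length [i.+1], since the most recent outcome comes
    first. *)
Definition word_event i : set R :=
  [set u | 0 <= u < 1 /\ head false (word i.+1 u)].

Lemma word_cylinderE n w : size w = n ->
  [set u | 0 <= u < 1 /\ word n u = w] = `[lft w, lft w + wgt w[%classic.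
Proof.
move=> sw; apply/seteqP; split => u; rewrite /= in_itv/=.
  by move=> [u01 /(wordP u01 sw)].
move=> /andP[u0 u1]; have u01 : 0 <= u < 1.
  by rewrite (le_trans (lft_ge0 w) u0) (lt_le_trans u1 (lft_wgt_le1 w)).
by split => //; apply/wordP => //; rewrite u0.
Qed.

Lemma measurable_word_event i : measurable (word_event i : set (measurableTypeR R)).
Proof.
have -> : word_event i =
    \bigcup_(w in [set w | size w = i.+1 /\ head false w])
      `[lft w, lft w + wgt w[%classic.
  apply/seteqP; split => u.
    move=> [u01 hu]; exists (word i.+1 u); first by split => //; rewrite size_word.
    by rewrite -(@word_cylinderE i.+1) ?size_word.
  by move=> [w [sw hw]]; rewrite -(word_cylinderE sw) => -[u01 wE]; split; rewrite // wE.
apply: (sigma_bigcup_count (sigma_algebra_measurable (measurableTypeR R))).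
by move=> w _; exact: measurable_itv.
Qed.

Local Notation P := (uniform_prob (@ltr01 R)).

Lemma uniform_prob_itvco (x y : R) : 0 <= x -> x <= y -> y <= 1 ->
  P `[x, y[%classic = (y - x)%:E.
Proof.
move=> x0 xy y1; rewrite /uniform_prob integral_uniform_pdf.
have -> : `[x, y[%classic `&` `[0, 1]%classic = `[x, y[%classic :> set R.
  apply: setIidl => u; rewrite /= !in_itv/= => /andP[xu uy].
  by rewrite (le_trans x0 xu) (le_trans (ltW uy) y1).
rewrite (eq_integral (fun=> 1%E)); last first.
  move=> u; rewrite inE/= in_itv/= => /andP[xu uy].
  rewrite /uniform_pdf (le_trans x0 xu) (le_trans (ltW uy) y1)/=.
  by rewrite subr0 invr1.
rewrite integral_cst//= mul1e lebesgue_measure_itv/= lte_fin.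
move: xy; rewrite le_eqVlt => /orP[/eqP->|->//].
by rewrite ltxx subrr.
Qed.

Definition word_cylinder n m w (s : seq nat) : set R :=
  [set u | (0 <= u < 1 /\ word n u = w) /\
    forall i, (n <= i < n + m)%N && (i \in s) -> word_event i u].

Lemma measurable_word_cylinder n m w s : size w = n ->
  measurable (word_cylinder n m w s : set (measurableTypeR R)).
Proof.
move=> sw.
have -> : word_cylinder n m w s = `[lft w, lft w + wgt w[%classic `&`
   \bigcap_(i in [set i | (n <= i < n + m)%N && (i \in s)]) word_event i.
  by rewrite -(word_cylinderE sw).
apply: measurableI => //; apply: bigcap_measurableType => i _.
exact: measurable_word_event.
Qed.

Lemma fmax_maxdiff_split w h :
  maxdiff Phi (zeros (true :: w)) (fmax (ones (true :: w)) h) +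
  maxdiff Phi (zeros (false :: w)) (fmax (ones (false :: w)) h) =
  maxdiff Phi (zeros w) (fmax (ones w) h).
Proof.
by rewrite /= -!fmaxA (fmaxC h); ring.
Qed.

(** Induction on [m]. If [n \in s], outcome [n] must be [true]; otherwise both outcomes contribute
    and [fmax_maxdiff_split] merges them. For [m = 0] the cylinder is an interval of length
    [wgt w]. *)
Lemma prob_word_cylinder n m w s : size w = n ->
  P (word_cylinder n m w s) =
  (maxdiff Phi (zeros w)
    (fmax (ones w) (fmaxs [seq F i | i <- iota n m & i \in s])))%:E.
Proof.
elim: m n w => [|m IH] n w sw.
  have -> : word_cylinder n 0 w s = `[lft w, lft w + wgt w[%classic.
    rewrite -(word_cylinderE sw); apply/seteqP; split => u; first by case.
    by split => // i; rewrite addn0 leqNgt andNb.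
  rewrite uniform_prob_itvco ?lft_ge0 ?lft_wgt_le1 ?lerDl ?wgt_ge0//.
  rewrite addrAC subrr add0r /= fmaxC fmax_r// => x.
  exact: USC_ge0 (USC_ones w) x.
have sT : size (true :: w) = n.+1 by rewrite /= sw.
have sF : size (false :: w) = n.+1 by rewrite /= sw.
have T_E : word_cylinder n.+1 m (true :: w) s `<=` word_event n.
  by move=> u [[u01 wE] _]; split => //; rewrite wE.
have F_E u : word_cylinder n.+1 m (false :: w) s u -> ~ word_event n u.
  by move=> [[_ wE] _] [_]; rewrite wE.
have sub v : (v || (n \notin s)) ->
    word_cylinder n.+1 m (v :: w) s `<=` word_cylinder n m.+1 w s.
  move=> vs u [[u01 wE] us]; split.
    by split => //; move: wE => /= -[_].
  move=> i /andP[/andP[ni im] si].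
  move: ni; rewrite leq_eqVlt => /predU1P[nE|ni].
    move: vs; rewrite nE si orbF => vT.
    by rewrite -nE; split => //; rewrite wE.
  by apply: us; rewrite ni addSnnS im.
have sub' u : word_cylinder n m.+1 w s u -> exists v,
    word_cylinder n.+1 m (v :: w) s u.
  move=> [[u01 wE] us]; exists (u < lft w + wgt (true :: w)).
  split; first by split => //=; rewrite wE.
  move=> i /andP[/andP[ni im] si]; apply: us.
  by rewrite ltnW// addnS -addSn im.
have [ns|ns] := boolP (n \in s).
  have -> : word_cylinder n m.+1 w s = word_cylinder n.+1 m (true :: w) s.
    apply/seteqP; split; last exact: sub.
    move=> u Hu; have [[] //] := sub' u Hu; move=> /F_E; case.
    by case: Hu => _; apply; rewrite leqnn addnS ltnS leq_addr.
  by rewrite IH//= ns /= sw -fmaxA.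
have -> : word_cylinder n m.+1 w s =
    word_cylinder n.+1 m (true :: w) s `|` word_cylinder n.+1 m (false :: w) s.
  apply/seteqP; split.
    by move=> u /sub'[[] Hu]; [left|right].
  by rewrite subUset; split; apply: sub.
rewrite measureU; do ?exact: measurable_word_cylinder; last first.
  by apply/seteqP; split => // u [/T_E + /F_E].
transitivity ((P (word_cylinder n.+1 m (true :: w) s) +
               P (word_cylinder n.+1 m (false :: w) s))%E) => //.
by rewrite !IH// -EFinD fmax_maxdiff_split//= (negbTE ns).
Qed.

Lemma fmaxs_leP (s : seq (E -> R)) x y :
  fmaxs s x <= y <-> 0 <= y /\ forall f, f \in s -> f x <= y.
Proof.
elim: s => [|f s IH] /=; first by split=> [|[]].
rewrite /fmax ge_max; split=> [/andP[fy /IH[y0 sy]]|[y0 sy]].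
  by split => // g; rewrite inE => /predU1P[->|/sy].
rewrite sy ?mem_head//=; apply/IH; split => // g gs.
by apply: sy; rewrite inE gs orbT.
Qed.

Lemma eq_fmaxs (s t : seq (E -> R)) : s =i t -> fmaxs s = fmaxs t.
Proof.
move=> st; apply/funext => x; apply/le_anti/andP; split; apply/fmaxs_leP.
  have /fmaxs_leP[t0 tt] := lexx (fmaxs t x).
  by split => // f; rewrite st; exact: tt.
have /fmaxs_leP[t0 tt] := lexx (fmaxs s x).
by split => // f; rewrite -st; exact: tt.
Qed.

Lemma prob_word_events (s : seq nat) :
  P [set u | forall i, i \in s -> word_event i u] = (Phi (fmaxs (map F s)))%:E.
Proof.
(* For the empty list the event is the whole line, whereas [word_cylinder] keeps [u] in [[0, 1[]. *)
have [->|s0] := eqVneq s [::].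
  rewrite /= Phi0 (_ : [set _ | _] = setT) ?probability_setT//.
  by apply/seteqP; split.
pose N := (\max_(i <- s) i).+1.
have sN i : i \in s -> (i < N)%N by move=> si; rewrite ltnS leq_bigmax_seq.
have -> : [set u | forall i, i \in s -> word_event i u] = word_cylinder 0 N [::] s.
  apply/seteqP; split => u.
    move=> us; split; last by move=> i /andP[_ /us].
    have : head 0%N s \in s by case: (s) s0 => // i t _; rewrite mem_head.
    by move=> /us[].
  by move=> [_ us] i si; apply: us; rewrite add0n sN.
rewrite prob_word_cylinder//; set h := fmaxs _; rewrite /= fmax_r; last first.
  by move=> x; have /fmaxs_leP[] := lexx (h x).
congr (Phi _)%:E; apply: eq_fmaxs => f.
apply/mapP/mapP => -[i]; first by rewrite mem_filter => /andP[si _] ->; exists i.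
move=> si ->; exists i => //.
by rewrite mem_filter si mem_iota add0n sN.
Qed.

End EventsOfMaxDiff.

Lemma exists_events (E : topologicalType) (R : realType) (I : countType)
    (Phi : (E -> R) -> R) (F : I -> E -> R) :
  max_completely_monotone (@USC E R) Phi -> Phi (fun=> 0) = 1 ->
  (forall i, USC (F i)) ->
  exists (P : probability (measurableTypeR R) R) (A : I -> set (measurableTypeR R)),
    (forall i, measurable (A i)) /\
    forall s : seq I, P [set u | forall i, i \in s -> A i u] =
      (Phi (fmaxs (map F s)))%:E.
Proof.
move=> mP P0 FU.
(* Numbers that encode no index are assigned the zero function, which turns the countable family
   into a sequence. *)
pose G n := if unpickle n is Some i then F i else (fun=> 0).
have GU n : USC (G n) by rewrite /G; case: unpickle => // *; exact: USC0.
exists (uniform_prob (@ltr01 R)), (fun i => word_event Phi G (pickle i)).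
split=> [i|s]; first exact: measurable_word_event.
have -> : map F s = map G (map pickle s).
  by rewrite -map_comp; apply: eq_map => i /=; rewrite /G pickleK.
rewrite -(prob_word_events mP P0 GU); congr (uniform_prob _ _).
apply/seteqP; split => u /= us i; first by move=> /mapP[j /us + ->].
by move=> si; apply: us; exact: map_f.
Qed.

(** * Construction of the random sup-measure *)

Section ExtremalIntegral.
Context {E : topologicalType} {R : realType} {b : nat -> set E}.
Hypotheses (hE : hausdorff_space E) (hb : nbhs_base b).
Variable phi : set E -> \bar R.
Hypothesis pS : supmeasure phi.

Lemma eint_fmax_le f g (t : R) : USC f -> USC g -> 0 <= t ->
  (eint (fmax f g) phi <= t%:E)%E <->
  (eint f phi <= t%:E)%E /\ (eint g phi <= t%:E)%E.
Proof.
move=> fU gU t0; have f0 := USC_ge0 fU; have g0 := USC_ge0 gU.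
have fgE x : fmax f g x * dens phi x = Num.max (f x * dens phi x) (g x * dens phi x).
  by rewrite /fmax maxr_pMl// dens_ge0.
have fg0 := USC_ge0 (USC_fmax fU gU).
split=> [/(eint_leP hE hb pS fg0 t0) H|].
  by split; apply/(eint_leP hE hb pS) => // x; have := H x; rewrite fgE ge_max => /andP[].
move=> [/(eint_leP hE hb pS f0 t0) H1 /(eint_leP hE hb pS g0 t0) H2].
apply/(eint_leP hE hb pS fg0 t0) => x.
by rewrite fgE ge_max H1 H2.
Qed.

Lemma eint_cap_le u L (t : R) : compact L -> 0 <= u -> 0 <= t ->
  (eint (cap_fun u L) phi <= t%:E)%E <-> (u%:E * phi L <= t%:E)%E.
Proof.
move=> cL u0 t0; have fU := USC_cap_fun hE u0 cL.
have [p0 _] := pS.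
have -> : (u%:E * phi L <= t%:E)%E <-> forall x, L x -> u * dens phi x <= t.
  move: u0 {fU}; rewrite le_eqVlt => /orP[/eqP<-|u0].
    by rewrite mul0e lee_fin; split => // _ x _; rewrite mul0r.
  rewrite muleC -lee_pdivlMr// -EFinM.
  split => [/(supmeasure_leP hE hb _ pS (divr_ge0 t0 (ltW u0))) H x Lx|H].
    by rewrite mulrC -ler_pdivlMr//; exact: H.
  apply/(supmeasure_leP hE hb _ pS (divr_ge0 t0 (ltW u0))) => x Lx.
  by rewrite ler_pdivlMr// mulrC; exact: H.
split=> [/(eint_leP hE hb pS (USC_ge0 fU) t0) H x Lx|H].
  by have := H x; rewrite /cap_fun indicE mem_set// mulr1.
apply/(eint_leP hE hb pS (USC_ge0 fU) t0) => x.
rewrite /cap_fun indicE; have [Lx|nLx] := pselect (L x).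
  by rewrite mem_set// mulr1; exact: H.
by rewrite memNset// mulr0 mul0r.
Qed.

(** Translates the finite maxima in the definition of [max_stable] into the extremal integral of a
    single function of [USC]. *)
Lemma eint_fmaxs_le (s : seq (R * set E)) (t : R) :
  (forall p, p \in s -> 0 <= p.1 /\ compact p.2) -> 0 <= t ->
  (eint (fmaxs [seq cap_fun p.1 p.2 | p <- s]) phi <= t%:E)%E <->
  (\big[maxe/0%E]_(p <- s) (p.1%:E * phi p.2) <= t%:E)%E.
Proof.
move=> sP t0; elim: s sP => [|[u L] s IH] sP.
  rewrite big_nil lee_fin; split => // _.
  by apply/(eint_leP hE hb pS) => // x; rewrite mul0r.
have [u0 cL] := sP _ (mem_head _ _).
have sP' p : p \in s -> 0 <= p.1 /\ compact p.2.
  by move=> ps; apply: sP; rewrite inE ps orbT.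
rewrite big_cons ge_max /=.
have sU : USC (fmaxs [seq cap_fun p.1 p.2 | p <- s]).
  by apply: USC_fmaxs => _ /mapP[p /sP'[p0 cp] ->]; exact: USC_cap_fun.
split.
  move=> /(eint_fmax_le (USC_cap_fun hE u0 cL) sU t0)[/eint_cap_le H1 /IH H2].
  by rewrite H1// H2.
move=> /andP[H1 H2]; apply/(eint_fmax_le (USC_cap_fun hE u0 cL) sU t0).
by split; [exact/eint_cap_le | exact/IH].
Qed.

Lemma eint_scale_le c f (t : R) : 0 < c -> USC f -> 0 <= t ->
  (eint (scale c f) phi <= t%:E)%E <-> (eint f phi <= (t / c)%:E)%E.
Proof.
move=> c0 fU t0; have cU := USC_scale c0 fU.
have tc : 0 <= t / c by rewrite divr_ge0// ltW.
have aux x : (scale c f x * dens phi x <= t) = (f x * dens phi x <= t / c).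
  by rewrite /scale ler_pdivlMr// -mulrA mulrC.
split=> [/(eint_leP hE hb pS (USC_ge0 cU) t0) H|/(eint_leP hE hb pS (USC_ge0 fU) tc) H].
  by apply/(eint_leP hE hb pS (USC_ge0 fU) tc) => x; rewrite -aux; exact: H.
by apply/(eint_leP hE hb pS (USC_ge0 cU) t0) => x; rewrite aux; exact: H.
Qed.

End ExtremalIntegral.

(** * Approximation of [USC] functions from above by codes *)

Section Existence.
Context {E : topologicalType} {R : realType} {b : nat -> set E}.
Hypotheses (hE : hausdorff_space E) (hb : nbhs_base b).
Variable l : (E -> R) -> R.
Implicit Types f : E -> R.
Hypotheses (l_ge0 : forall f, USC f -> 0 <= l f) (l_hom : homogeneous l).
Hypotheses (l_mca : max_completely_alternating l) (l_usc : usc_functional l).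

Lemma hom0 : l (fun=> 0) = 0.
Proof.
have := @l_hom 2 _ (ltr0n _ _) USC0.
have -> : (fun=> 2 * 0 : R) = (fun=> 0) :> (E -> R) by apply/funext => x; rewrite mulr0.
by move=> H; lra.
Qed.

(** Truncation at 0 gives negative rationals the zero function, so every code yields an element of
    [USC]. *)
Definition atom (c : nat * rat) : E -> R :=
  cap_fun (Num.max 0 (ratr c.2)) (closure (b c.1)).

Lemma USC_atom c : USC (atom c).
Proof. by apply: USC_cap_fun => //; [rewrite le_max lexx|have [_ + _] := hb]. Qed.

Local Notation env s := (fmaxs (map atom s)).

Lemma USC_sup s : USC (env s).
Proof. by apply: USC_fmaxs => _ /mapP[c _ ->]; exact: USC_atom. Qed.

Lemma atom_le_sup c s x : c \in s -> atom c x <= env s x.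
Proof.
by move=> cs; have /fmaxs_leP[_] := lexx (env s x); apply; exact: map_f.
Qed.

Lemma prec_le_sup f s : prec b f s -> forall x, f x <= env s x.
Proof.
move=> fs x; have [fx|/supp0->] := pselect (supp f x); last exact: USC_ge0 (USC_sup s) x.
have [c cs [bx fc]] := fs x fx; apply: le_trans (atom_le_sup x cs).
rewrite /atom /cap_fun indicE mem_set ?mulr1 ?le_max ?(ltW fc) ?orbT//.
exact: subset_closure.
Qed.

(** Around each point of the support, a base set whose closure lies in one set of each list, with
    the smaller of the two rationals, is below both; compactness keeps finitely many of them. *)
Lemma prec_directed f s t : USC f -> prec b f s -> prec b f t ->
  exists r, [/\ prec b f r, (forall x, env r x <= env s x) &
                forall x, env r x <= env t x].
Proof.
move=> fU fs ft; have [bo _ xb] := hb.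
pose below (s : seq (nat * rat)) (c : nat * rat) := exists2 c', c' \in s &
  closure (b c.1) `<=` b c'.1 /\ (ratr c.2 : R) <= ratr c'.2.
have below_sup u (r : seq (nat * rat)) : (forall c, c \in r -> below u c) ->
    forall x, env r x <= env u x.
  move=> ru x; apply/fmaxs_leP; split; first exact: USC_ge0 (USC_sup u) x.
  move=> _ /mapP[c /ru[c' c'u [bc vc]] ->]; apply: le_trans (atom_le_sup x c'u).
  rewrite /atom /cap_fun !indicE; have [xc|xc] := pselect (closure (b c.1) x).
    rewrite !mem_set//; first by rewrite !mulr1 ge_max !le_max lexx vc orbT.
    by apply: subset_closure; exact: bc.
  by rewrite (memNset xc) mulr0 mulr_ge0// le_max lexx.
have [x fx|r rQ fr] := @prec_cover E R b f (fun c => below s c /\ below t c) hb fU.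
  have [c1 c1s [bx1 f1]] := fs x fx; have [c2 c2t [bx2 f2]] := ft x fx.
  have [n nx nb] := xb x (b c1.1 `&` b c2.1)
    (open_nbhs_nbhs (conj (openI (bo _) (bo _)) (conj bx1 bx2))).
  have nb1 : closure (b n) `<=` b c1.1 by move=> y /nb[].
  have nb2 : closure (b n) `<=` b c2.1 by move=> y /nb[].
  have [v12|v21] := leP (ratr c1.2 : R) (ratr c2.2).
    by exists (n, c1.2) => //; split; [exists c1|exists c2].
  by exists (n, c2.2) => //; split; [exists c1 => //; split => //; exact: ltW|exists c2].
by exists r; split => //; apply: below_sup => c /rQ[].
Qed.

(** Points other than [x0] are covered by base sets whose closure avoids [x0], so only codes with
    rational at most [f x0 + e] count at [x0]. *)
Lemma prec_near f x0 e : USC f -> 0 < e ->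
  exists2 s, prec b f s & env s x0 <= f x0 + e.
Proof.
move=> fU e0; have [bo _ xb] := hb.
have [x fx|s sQ fs] := @prec_cover E R b f (fun c =>
    ~ closure (b c.1) x0 \/ (ratr c.2 : R) <= f x0 + e) hb fU.
  have [<-|xx0] := pselect (x = x0).
    have [n nx _] := xb x setT filterT.
    have : f x < f x + e by rewrite ltrDl.
    move=> /rat_in_itvoo[q]; rewrite in_itv/= => /andP[fq qf].
    by exists (n, q) => //; right; exact: ltW.
  have ox0 : open (~` [set x0]) by rewrite openC; apply: compact_closed => //; exact: compact_set1.
  have [n nx nb] := xb x _ (open_nbhs_nbhs (conj ox0 xx0)).
  have : f x < f x + 1 by rewrite ltrDl.
  move=> /rat_in_itvoo[q]; rewrite in_itv/= => /andP[fq _].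
  by exists (n, q) => //; left => /nb; apply.
exists s => //; apply/fmaxs_leP; have fe0 : 0 <= f x0 + e.
  by rewrite addr_ge0 ?(USC_ge0 fU)// ltW.
split => // _ /mapP[c /sQ cQ ->]; rewrite /atom /cap_fun indicE.
case: cQ => [nx0|cx0]; first by rewrite memNset// mulr0.
case: (_ \in _); last by rewrite mulr0.
by rewrite mulr1 ge_max fe0.
Qed.

(** [h] enumerates all lists above [f], and [g] refines them successively by [prec_directed]. The
    envelopes of [g] then decrease to [f], and upper semicontinuity of [l] gives the limit. *)
Lemma prec_sequence f : USC f -> exists (h g : nat -> seq (nat * rat)),
  [/\ forall s, prec b f s -> exists i, h i = s,
      forall n, prec b f (h n), forall n, prec b f (g n),
      forall n i, (i < n)%N -> forall x, env (g n) x <= env (h i) x &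
      l (env (g n)) @[n --> \oo] --> l f].
Proof.
move=> fU.
have [s0 fs0] : exists s, prec b f s.
  have [[x0 _]|E0] := pselect ([set: E] !=set0).
    by have [s fs _] := @prec_near f x0 1 fU ltr01; exists s.
  by exists [::] => x _; exfalso; apply: E0; exists x.
pose h n := if unpickle n is Some s then if `[< prec b f s >] then s else s0 else s0.
have hP n : prec b f (h n).
  by rewrite /h; case: unpickle => // s; case: asboolP.
have hS s : prec b f s -> exists i, h i = s.
  by move=> fs; exists (pickle s); rewrite /h pickleK asboolT.
have /choice[D DP] : forall st : seq (nat * rat) * seq (nat * rat), exists r,
    prec b f st.1 -> prec b f st.2 ->
    [/\ prec b f r, (forall x, env r x <= env st.1 x) &
        forall x, env r x <= env st.2 x].
  move=> -[s t] /=.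
  have [fs|nfs] := pselect (prec b f s); last by exists s.
  have [ft|nft] := pselect (prec b f t); last by exists s.
  by have [r rP] := prec_directed fU fs ft; exists r.
pose g := fix g n := if n is n'.+1 then D (g n', h n') else s0.
have gP n : prec b f (g n) by elim: n => //= n IH; case: (DP (g n, h n) IH (hP n)).
have gS n x : env (g n.+1) x <= env (g n) x.
  by case: (DP (g n, h n) (gP n) (hP n)).
have gmono x : {homo (fun n => env (g n) x) : n m / (n <= m)%N >-> m <= n}.
  by apply/nonincreasing_seqP => n; exact: gS.
have gh n i : (i < n)%N -> forall x, env (g n) x <= env (h i) x.
  move=> im x; apply: le_trans (gmono x _ _ im) _.
  by case: (DP (g i, h i) (gP i) (hP i)).
exists h, g; split => //.
have [] // := @l_usc (fun n => env (g n)) f.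
- by move=> n; exact: USC_sup.
(* The list supplied by [prec_near] is some [h i], and every [g n] with [n > i] has its envelope
   below that of [h i]. *)
- move=> x; apply/cvgrPdist_le => e e0; have [s fs sx] := prec_near x fU e0.
  have [i hi] := hS s fs.
  exists i.+1 => // n /= iltn; rewrite ler0_norm; last first.
    by rewrite subr_le0; apply: prec_le_sup.
  rewrite opprB lerBlDl; apply: le_trans sx; rewrite -hi; exact: gh.
Qed.

(** * The random sup-measure defined by a family of events *)

Section Events.
Variables (d : measure_display) (Omega : measurableType d).
Variables (P : probability Omega R) (A : nat * rat -> set Omega).
Hypothesis mA : forall c, measurable (A c).

Definition joint_event (s : seq (nat * rat)) : set Omega :=
  [set u | forall c, c \in s -> A c u].

Hypothesis PA : forall s, P (joint_event s) = (expR (- l (env s)))%:E.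

Lemma measurable_joint_event s : measurable (joint_event s).
Proof.
have := sets_on_all (sigma_algebra_measurable Omega)
  (Q := [set c | c \in s]) (P := fun c u => A c u).
rewrite (_ : sets_on _ _ = joint_event s); first apply.
  by move=> c _; have := mA c; congr measurable; apply/seteqP; split=> u; [split|case].
by apply/seteqP; split => u; [case | split].
Qed.

(** Stands for the event that [f] times the random density is below 1 everywhere; [below_eventP]
    confirms this on [good_event]. *)
Definition below_event f : set Omega :=
  [set u | exists2 s, prec b f s & joint_event s u].

Lemma measurable_below_event f : measurable (below_event f).
Proof.
have := sigma_bigcup_count (sigma_algebra_measurable Omega)
  (Q := [set s | prec b f s]) (F := joint_event) => H.
by apply: H => s _; exact: measurable_joint_event.
Qed.

(** Appending [t] to [s] leaves the envelope unchanged, so [PA] gives the joint events of [s] and of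
    [s ++ t] the same probability. The inclusion thus holds almost surely, though perhaps not
    pointwise. *)
Lemma joint_event_diff0 s t : (forall x, env t x <= env s x) ->
  P (joint_event s `\` joint_event t) = 0%E.
Proof.
move=> ts; have stE : joint_event s `&` joint_event t = joint_event (s ++ t).
  apply/seteqP; split=> u.
    by move=> [us ut] c; rewrite mem_cat => /orP[/us|/ut].
  by move=> ust; split=> c cs; apply: ust; rewrite mem_cat cs ?orbT.
have := measureD (measurable_joint_event s) (measurable_joint_event t) (mu := P).
rewrite (_ : (P (joint_event s) < +oo)%E); last by rewrite PA ltry.
move=> /(_ isT); rewrite stE => ->.
transitivity (P (joint_event s) - P (joint_event (s ++ t)))%E => //.
rewrite !PA map_cat fmaxs_cat fmaxC fmax_r//.
by rewrite -EFinB subrr.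
Qed.

Lemma le_measure_diff0 (B C : set Omega) : measurable B -> measurable C ->
  P (B `\` C) = 0%E -> (P B <= P C)%E.
Proof.
move=> mB mC BC; rewrite -(measureU0 mC (measurableD mB mC) BC).
apply: le_measure; rewrite ?inE//; first exact: measurableU (measurableD _ _).
by move=> u Bu; have [Cu|nCu] := pselect (C u); [left|right].
Qed.

(** The events of the lists [g n] lie inside [below_event f], and their probabilities tend to
    [exp (- l f)], whence the lower bound. *)
Lemma prob_below_event f : USC f -> P (below_event f) = (expR (- l f))%:E.
Proof.
move=> fU; have [h [g [hS hP gP gh lg]]] := prec_sequence fU.
apply/le_anti/andP; split; last first.
  have cvg_e : (expR (- l (env (g n))))%:E @[n --> \oo] --> (expR (- l f))%:E.
    apply: cvg_EFin; first exact: nearW.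
    apply: continuous_cvg; first exact: continuous_expR.
    exact: cvgN.
  apply: cvge_le cvg_e; apply: nearW => n; rewrite -PA.
  apply: le_measure; rewrite ?inE; [exact: measurable_joint_event|exact: measurable_below_event|].
  by move=> u gu; exists (g n).
(* For the upper bound, [V n] increases to [below_event f] and is almost surely contained in the
   event of [g n], whose probability is at most [exp (- l f)] because its envelope dominates [f]. *)
pose V n := \bigcup_(i in [set i | (i < n)%N]) joint_event (h i).
have mV n : measurable (V n) by apply: bigcup_measurable => i _; exact: measurable_joint_event.
have VE : \bigcup_n V n = below_event f.
  apply/seteqP; split=> u.
    by move=> [n _ [i _ hu]]; exists (h i).
  move=> [s fs su]; have [i hi] := hS s fs.
  by exists i.+1 => //; exists i => //=; rewrite hi.
have Vmono : {homo V : n m / (n <= m)%N >-> (n <= m)%O}.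
  move=> n m nm; apply/subsetPset => u [i /= iltn hu].
  by exists i => //=; exact: leq_trans iltn nm.
have := nondecreasing_cvg_mu mV _ Vmono (mu := P).
rewrite VE => /(_ (measurable_below_event f)).
apply: cvge_le; apply: nearW => n /=.
apply: (@le_trans _ _ (P (joint_event (g n)))); last first.
  rewrite PA lee_fin ler_expR lerN2; apply: mca_le => //; first exact: USC_sup.
  exact: prec_le_sup.
apply: le_measure_diff0 => //; first exact: measurable_joint_event.
suff H m : (m <= n)%N -> P (V m `\` joint_event (g n)) = 0%E by exact: H.
elim: m => [|m IH] mn.
  have -> : V 0%N `\` joint_event (g n) = set0 by rewrite -subset0 => u [[i]].
  exact: measure0.
have -> : V m.+1 `\` joint_event (g n) =
    (V m `\` joint_event (g n)) `|` (joint_event (h m) `\` joint_event (g n)).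
  apply/seteqP; split => u.
    move=> [[i /= im hu] ngu]; move: im; rewrite ltnS leq_eqVlt => /predU1P[im|im].
      by right; rewrite -im.
    by left; split => //; exists i.
  case=> -[]; last by move=> hu ngu; split => //; exists m => /=.
  by move=> [i /= im hu] ngu; split => //; exists i => //=; exact: ltnW.
rewrite measureU0.
- exact: IH (ltnW mn).
- by apply: measurableD => //; exact: measurable_joint_event.
- by apply: measurableD; exact: measurable_joint_event.
- by apply: joint_event_diff0; exact: gh.
Qed.

(** Each base set receives a finite bound [1 / q], so that the infima defining the density are taken
    over nonempty sets. *)
Definition good_event : set Omega :=
  [set u | forall n, exists2 q : rat, 0 < (ratr q : R) & A (n, q) u].

Lemma prob_good_event : measurable good_event /\ P (~` good_event) = 0%E.
Proof.
pose N n := ~` \bigcup_(q in [set q : rat | 0 < (ratr q : R)]) A (n, q).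
have mN n : measurable (N n).
  apply: measurableC.
  by apply: (sigma_bigcup_count (sigma_algebra_measurable Omega)) => q _.
have NE : ~` good_event = \bigcup_n N n.
  apply/seteqP; split=> u.
    by move=> /existsNP[n nu]; exists n => // -[q q0 qu]; apply: nu; exists q.
  by move=> [n _ nu] gu; apply: nu; have [q q0 qu] := gu n; exists q.
have mG : measurable (~` good_event) by rewrite NE; exact: bigcupT_measurable.
split; first by rewrite -[good_event]setCK; exact: measurableC.
have PN n : P (N n) = 0%E.
  have [_ cb _] := hb.
  pose f := cap_fun (1 : R) (closure (b n)).
  have fU : USC f by exact: USC_cap_fun.
  apply/le_anti/andP; split; last exact: measure_ge0.
  have cvg1 : (1 - expR (- (k.+1%:R^-1 * l f)))%:E @[k --> \oo] --> 0%:E.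
    have -> : 0%:E = (1 - expR (- (0 * l f)))%:E.
      by rewrite mul0r oppr0 expR0 subrr.
    apply: cvg_EFin; first exact: nearW.
    apply: cvgB; first exact: cvg_cst.
    apply: continuous_cvg; first exact: continuous_expR.
    apply: cvgN; apply: cvgMr_tmp; exact: cvg_harmonic.
  apply: cvge_ge cvg1; apply: nearW => k.
  (* By homogeneity this code fails with probability [1 - exp (- l f / (k + 1))], which tends to
     0. *)
  pose c := (n, k.+1%:R^-1 : rat).
  have c0 : 0 < (ratr c.2 : R) by rewrite ltr0q invr_gt0.
  apply: (@le_trans _ _ (P (~` joint_event [:: c]))).
    apply: le_measure; rewrite ?inE//; first exact/measurableC/measurable_joint_event.
    by move=> u nu cu; apply: nu; exists c.2 => //; apply: cu; rewrite inE.
  rewrite probability_setC ?PA -?EFinB; last exact: measurable_joint_event.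
  rewrite /= fmaxC fmax_r; last by move=> x; exact: USC_ge0 (USC_atom c) x.
  have -> : atom c = (fun x => k.+1%:R^-1 * f x).
    apply/funext => x; rewrite /atom /f /cap_fun max_r ?(ltW c0)//.
    by rewrite mul1r /= fmorphV /= ratr_nat.
  by rewrite l_hom.
rewrite NE; apply: measure_negligible; first by rewrite -NE.
by apply: negligible_bigcup => n; exists (N n); split; [exact: mN|exact: PN|].
Qed.

Definition dens_set u x : set R := [set (ratr c.2)^-1 | c in
  [set c | [/\ 0 < (ratr c.2 : R), b c.1 x & A c u]]].

(* [A c] plays the role of the event q phi(closure (b n)) <= 1, c = (n, q). *)
Definition random_dens u x : R :=
  if `[< good_event u >] then inf (dens_set u x) else 0.

Lemma dens_set_has_inf u x : good_event u -> has_inf (dens_set u x).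
Proof.
have [_ _ xb] := hb; have [n nx _] := xb x setT filterT.
move=> gu; split.
  by have [q q0 qu] := gu n; exists (ratr q)^-1, (n, q).
by exists 0 => _ [c [c0 _ _] <-]; rewrite invr_ge0 ltW.
Qed.

Lemma random_dens_ge0 u x : 0 <= random_dens u x.
Proof.
rewrite /random_dens; case: asboolP => // gu.
apply: lb_le_inf; first by case: (dens_set_has_inf x gu).
by move=> _ [c [c0 _ _] <-]; rewrite invr_ge0 ltW.
Qed.

Lemma random_dens_le u x c : good_event u -> 0 < (ratr c.2 : R) -> b c.1 x ->
  A c u -> random_dens u x <= (ratr c.2)^-1.
Proof.
move=> gu c0 cx cu; rewrite /random_dens asboolT//; apply: ge_inf.
  by case: (dens_set_has_inf x gu).
by exists c.
Qed.

Lemma random_dens_lt u x t : good_event u -> random_dens u x < t ->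
  exists2 c, A c u & [/\ 0 < (ratr c.2 : R), b c.1 x & (ratr c.2)^-1 < t].
Proof.
move=> gu; rewrite /random_dens asboolT// => /(inf_lt (dens_set_has_inf x gu).1).
by move=> [_ [c [c0 cx cu] <-] ct]; exists c.
Qed.

Lemma open_random_dens u t : open [set x | random_dens u x < t].
Proof.
have [gu|ngu] := pselect (good_event u).
  rewrite openE => x /= /(random_dens_lt gu)[c cu [c0 cx ct]].
  have [bo _ _] := hb.
  apply: (@filterS _ _ _ (b c.1)); last exact: open_nbhs_nbhs.
  by move=> y cy /=; apply: le_lt_trans ct; exact: random_dens_le.
rewrite (_ : mkset _ = (fun x => 0 < t)); last first.
  by apply/funext => x; rewrite /= /random_dens asboolF.
have [t0|t0] := ltP 0 t.
  by rewrite (_ : (fun=> _) = setT); [exact: openT | apply/seteqP; split].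
by rewrite (_ : (fun=> _) = set0); [exact: open0 | apply/seteqP; split].
Qed.

Definition random_sup u : set E -> \bar R := supm (random_dens u).

Lemma supmeasure_random_sup u : supmeasure (random_sup u).
Proof.
by apply: (supmeasure_supm hE); exact: open_random_dens.
Qed.

(** A code that occurs bounds the density by [1 / q] on its base set. Conversely a strict bound at a
    point produces an occurring code above [f] there, and [prec_cover] makes the choice finite. *)
Lemma below_eventP u f : good_event u -> USC f ->
  below_event f u <-> forall x, f x * dens (random_sup u) x < 1.
Proof.
move=> gu fU.
have dE x : dens (random_sup u) x = random_dens u x.
  by apply: dens_supm => y; exact: random_dens_ge0.
split=> [[s fs su] x|fd].
  rewrite dE; move: x; apply: prec_mul_lt1 fs _ => //.
    by move=> x; exact: random_dens_ge0.
  (* A code with non-positive rational gives no bound on the density, but then the product is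
     non-positive. *)
  move=> c x cs cx; have [c0|c0] := ltP 0 (ratr c.2 : R).
    by rewrite mulrC -ler_pdivlMr// mul1r random_dens_le//; exact: su.
  by apply: le_trans ler01; rewrite mulr_le0_ge0// random_dens_ge0.
have [x fx|s sQ fs] := @prec_cover E R b f (fun c => A c u) hb fU; last by exists s.
have [q [fq q0 dq]] := exists_rat_mul_lt1 (USC_ge0 fU x)
  (dens_ge0 x (supmeasure_random_sup u)) (fd x).
move: dq; rewrite dE => dq.
have [c cu [c0 cx cq]] := random_dens_lt gu dq.
exists c => //; split => //; apply: lt_trans fq _.
by rewrite -ltf_pV2 ?posrE.
Qed.

Definition eint_event f t : set Omega := [set u | (eint f (random_sup u) <= t%:E)%E].

Lemma eint_eventP f t u : good_event u -> USC f -> 0 < t -> eint_event f t u <->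
  forall k, below_event (scale (t + k.+1%:R^-1)^-1 f) u.
Proof.
move=> gu fU t0; have pS := supmeasure_random_sup u.
have cU k : USC (scale (t + k.+1%:R^-1)^-1 f).
  by apply: USC_scale => //; rewrite invr_gt0 addr_gt0.
split=> [/(eint_leP hE hb pS (USC_ge0 fU) (ltW t0))/(le_all_lt1P _ _ t0) H k|H].
  by apply/below_eventP.
apply/(eint_leP hE hb pS (USC_ge0 fU) (ltW t0))/(le_all_lt1P _ _ t0) => k.
by apply/below_eventP.
Qed.

Lemma measurable_eint_event f t : USC f -> 0 < t -> measurable (eint_event f t).
Proof.
move=> fU t0; have [mG _] := prob_good_event.
(* Outside [good_event] the density is 0, so the extremal integral is below [t] there. *)
have -> : eint_event f t = (good_event `&`
    \bigcap_k below_event (scale (t + k.+1%:R^-1)^-1 f)) `|` ~` good_event.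
  apply/seteqP; split=> u.
    move=> fu; have [gu|] := pselect (good_event u); last by right.
    by left; split => // k _; exact: (eint_eventP gu fU t0).1 fu k.
  case=> [[gu fu]|ngu]; first by apply/(eint_eventP gu fU t0) => k; exact: fu.
  apply/(eint_leP hE hb (supmeasure_random_sup u) (USC_ge0 fU) (ltW t0)) => x.
  rewrite dens_supm; last by move=> y; exact: random_dens_ge0.
  by rewrite /random_dens asboolF// mulr0 ltW.
apply: measurableU; last exact: measurableC.
apply: measurableI => //; apply: bigcapT_measurable => k.
exact: measurable_below_event.
Qed.

Lemma le_prob_good (B C : set Omega) : measurable B -> measurable C ->
  good_event `&` B `<=` C -> (P B <= P C)%E.
Proof.
move=> mB mC BC; have [mG G0] := prob_good_event.
rewrite -(measureU0 mC (measurableC mG) G0); apply: le_measure; rewrite ?inE//.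
  by apply: measurableU => //; exact: measurableC.
by move=> u Bu; have [gu|] := pselect (good_event u); [left; exact: BC | right].
Qed.

(** On [good_event], the event lies between [f d < t] and [f d < t + 1 / (k + 1)] everywhere, [d]
    being the density; both probabilities are known, and [k] tends to infinity. *)
Lemma prob_eint_event f t : USC f -> 0 < t ->
  P (eint_event f t) = (expR (- (l f / t)))%:E.
Proof.
move=> fU t0.
have lE c : 0 < c -> l (scale c^-1 f) = l f / c.
  by move=> c0; rewrite [LHS]l_hom ?invr_gt0// mulrC.
have sU c : 0 < c -> USC (scale c^-1 f).
  by move=> c0; apply: USC_scale => //; rewrite invr_gt0.
have mE := measurable_eint_event fU t0.
apply/le_anti/andP; split.
  have cvg1 : (expR (- (l f / (t + k.+1%:R^-1))))%:E @[k --> \oo] -->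
      (expR (- (l f / t)))%:E.
    apply: cvg_EFin; first exact: nearW.
    apply: continuous_cvg; first exact: continuous_expR.
    apply: cvgN; apply: cvgMl_tmp; apply: cvgV; first by rewrite gt_eqF.
    rewrite -[X in _ --> X]addr0; apply: cvgD; first exact: cvg_cst.
    exact: cvg_harmonic.
  apply: cvge_ge cvg1; apply: nearW => k.
  have tk : 0 < t + k.+1%:R^-1 by rewrite addr_gt0.
  rewrite -lE// -prob_below_event; last exact: sU.
  apply: le_prob_good => //; first exact: measurable_below_event.
  by move=> u [gu /(eint_eventP gu fU t0)]; apply.
rewrite -lE// -prob_below_event; last exact: sU.
apply: le_prob_good => //; first exact: measurable_below_event.
move=> u [gu /(below_eventP gu (sU t t0)) H].
have pS := supmeasure_random_sup u.
apply/(eint_leP hE hb pS (USC_ge0 fU) (ltW t0)) => x.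
have := ltW (H x); rewrite /scale -mulrA mulrC ler_pdivrMr// mul1r.
exact.
Qed.

Lemma random_sup_tail_dep : tail_dep P random_sup l.
Proof. by move=> f fU; split; [exact: l_ge0 | move=> t; exact: prob_eint_event]. Qed.

Lemma random_sup_max_stable : max_stable P random_sup.
Proof.
split.
  split; first exact: supmeasure_random_sup.
  (* The sets with measurable preimage form a sigma-algebra, so only the generating events
     [eint f phi <= 1] need checking. *)
  apply: (@sv_borel_sub _ _ _ hE hb [set U | measurable (random_sup @^-1` U)]).
    split => /=; first by rewrite preimage_set0.
      move=> U mU; rewrite (_ : _ @^-1` _ = ~` (random_sup @^-1` U)).
        exact: measurableC.
      apply/seteqP; split => u /=; first by case.
      by move=> nU; split => //; exact: supmeasure_random_sup.
    by move=> U mU; rewrite preimage_bigcup; exact: bigcupT_measurable.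
  move=> f fU /=; have := measurable_eint_event fU ltr01; congr measurable.
  apply/seteqP; split=> u /=; last by case.
  by move=> fu; split => //; exact: supmeasure_random_sup.
move=> s sP; pose f := fmaxs [seq cap_fun p.1 p.2 | p <- s].
have fU : USC f.
  by apply: USC_fmaxs => _ /mapP[p /sP[p0 cp] ->]; exact: USC_cap_fun.
exists (l f); split; first exact: l_ge0.
move=> t t0; rewrite -(prob_eint_event fU t0); congr (P _).
apply/seteqP; split => u.
  by move=> /(eint_fmaxs_le hE hb (supmeasure_random_sup u) sP (ltW t0)).
by move=> /(eint_fmaxs_le hE hb (supmeasure_random_sup u) sP (ltW t0)).
Qed.

End Events.

Lemma exists_max_stable : exists (P : probability (measurableTypeR R) R)
    (X : measurableTypeR R -> set E -> \bar R),
  max_stable P X /\ tail_dep P X l.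
Proof.
have [|P [A [mA PA]]] := @exists_events E R _ (fun f => expR (- l f)) atom
    (cmon_expRN l_mca) _ USC_atom.
  by rewrite hom0 oppr0 expR0.
exists P, (random_sup A); split.
  exact: random_sup_max_stable.
exact: random_sup_tail_dep.
Qed.

End Existence.

(** * Tail dependence functionals *)

(** With [y = x / n.+1], the inequality [1 + z <= exp z] at [z = y] and [z = - y] squeezes the
    sequence between [x / (1 + y)] and [x]. *)
Lemma cvg_mul_oneB_expRN (R : realType) (x : R) :
  n.+1%:R * (1 - expR (- (x / n.+1%:R))) @[n --> \oo] --> x.
Proof.
have cvg_low : x / (1 + x * n.+1%:R^-1) @[n --> \oo] --> x.
  suff : x / (1 + x * n.+1%:R^-1) @[n --> \oo] --> x / (1 + x * 0).
    by rewrite mulr0 addr0 divr1.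
  apply: cvgMl_tmp; apply: cvgV; first by rewrite mulr0 addr0 oner_neq0.
  by apply: cvgD; [exact: cvg_cst|apply: cvgMl_tmp; exact: cvg_harmonic].
apply: squeeze_cvgr cvg_low (cvg_cst x); near=> n.
have n0 : 0 < n.+1%:R :> R by [].
(* As [x] may be negative, this holds only for large [n]. *)
have y1 : 0 < 1 + x / n.+1%:R.
  rewrite -ltrBlDl sub0r ltr_pdivlMr// mulN1r.
  have : `|x| < n.+1%:R.
    apply: lt_le_trans (truncnS_gt _) _; rewrite ler_nat ltnS; near: n.
    exact: nbhs_infty_ge.
  by rewrite ltr_norml => /andP[].
have yE : x = n.+1%:R * (x / n.+1%:R) by rewrite mulrC divfK// gt_eqF.
move: y1 yE; set y := x / n.+1%:R => y1 yE; apply/andP; split.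
  rewrite [X in X / _]yE -mulrA ler_pM2l// expRN.
  have ->: y / (1 + y) = 1 - (1 + y)^-1.
    by apply: (mulIf (lt0r_neq0 y1)); rewrite divfK ?gt_eqF// mulrBl mulVf ?gt_eqF//; ring.
  by rewrite lerD2l lerN2 lef_pV2 ?posrE ?expR_gt0//; exact: expR_ge1Dx.
rewrite [leRHS]yE ler_pM2l// lerBlDl -lerBlDr.
exact: expR_ge1Dx.
Unshelve. all: by end_near. Qed.

(** * Necessity of the three conditions *)

Section Necessity.
Context {E : topologicalType} {R : realType} {b : nat -> set E}.
Hypotheses (hE : hausdorff_space E) (hb : nbhs_base b).
Variables (d : measure_display) (Omega : measurableType d).
Variables (P : probability Omega R) (X : Omega -> set E -> \bar R).
Variable l : (E -> R) -> R.
Hypotheses (rX : random_supmeasure X) (lX : tail_dep P X l).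
Implicit Types f g h : E -> R.

Definition eint_le_event f t : set Omega := [set w | (eint f (X w) <= t%:E)%E].

Lemma preimage_sets_on_eint f t :
  X @^-1` sets_on (@supmeasure E R) (fun phi => (eint f phi <= t%:E)%E) =
  eint_le_event f t.
Proof. by apply/seteqP; split => w; [case | split => //; case: rX]. Qed.

Lemma measurable_eint_le_event f t : USC f -> 0 < t ->
  measurable (eint_le_event f t).
Proof.
move=> fU t0; rewrite -preimage_sets_on_eint.
by apply: rX.2; exact: (sv_borel_eint_le hE hb).
Qed.

Lemma prob_eint_le_event f t : USC f -> 0 < t ->
  P (eint_le_event f t) = (expR (- (l f / t)))%:E.
Proof. by move=> fU t0; have [_] := lX fU; apply. Qed.

Lemma tail_dep_homogeneous : homogeneous l.
Proof.
move=> c f c0 fU; have cU := USC_scale c0 fU.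
have : P (eint_le_event (scale c f) 1) = P (eint_le_event f c^-1).
  congr (P _); apply/seteqP; split => w.
    by move=> /(eint_scale_le hE hb (rX.1 w) c0 fU ler01); rewrite div1r.
  move=> H; apply/(eint_scale_le hE hb (rX.1 w) c0 fU ler01).
  by rewrite div1r.
rewrite !prob_eint_le_event ?invr_gt0// => -[/expR_inj/oppr_inj].
by rewrite divr1 invrK mulrC.
Qed.

Definition crossing_event t (gs : seq (E -> R)) h : set Omega :=
  eint_le_event h t `&` [set w | forall g, g \in gs -> ~ eint_le_event g t w].

(** Adding [g] to the list removes the outcomes with [eint g <= t], that is the crossing event of
    [fmax h g]; this is the recursion of [maxdiff]. *)
Lemma prob_crossing_event t gs h : 0 < t -> (forall g, g \in gs -> USC g) ->
  USC h -> measurable (crossing_event t gs h) /\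
  P (crossing_event t gs h) = (maxdiff (fun f => expR (- (l f / t))) gs h)%:E.
Proof.
move=> t0; elim: gs h => [|g gs IH] h gsU hU.
  have -> : crossing_event t [::] h = eint_le_event h t.
    by apply/seteqP; split => w; [case | split].
  by split; [exact: measurable_eint_le_event | rewrite prob_eint_le_event].
have gU : USC g by apply: gsU; rewrite mem_head.
have {}gsU g' : g' \in gs -> USC g' by move=> g'gs; apply: gsU; rewrite inE g'gs orbT.
have [m1 P1] := IH h gsU hU; have [m2 P2] := IH _ gsU (USC_fmax hU gU).
have sub : crossing_event t gs (fmax h g) `<=` crossing_event t gs h.
  move=> w [hw gw]; split => //.
  by have /(eint_fmax_le hE hb (rX.1 w) hU gU (ltW t0))[] := hw.
have -> : crossing_event t (g :: gs) h =
    crossing_event t gs h `\` crossing_event t gs (fmax h g).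
  apply/seteqP; split => w.
    move=> [hw gw]; split.
      by split => // g' g'gs; apply: gw; rewrite inE g'gs orbT.
    move=> [/(eint_fmax_le hE hb (rX.1 w) hU gU (ltW t0))[_ gw'] _].
    by apply: (gw g) => //; rewrite mem_head.
  move=> [[hw gw] nw]; split => // g'; rewrite inE => /predU1P[->|/gw//].
  move=> gw'; apply: nw; split => //.
  exact/(eint_fmax_le hE hb (rX.1 w) hU gU (ltW t0)).
split; first exact: measurableD.
transitivity (P (crossing_event t gs h) - P (crossing_event t gs (fmax h g)))%E.
  rewrite -{2}(setIidr sub); apply: measureD => //.
  by apply: le_lt_trans (ltry 1); exact: probability_le1.
by rewrite P1 P2.
Qed.

(* l f = lim t (1 - exp (- l f / t)) as t tends to infinity, and the
   differences of exp (- l / t) are probabilities. *)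
Lemma tail_dep_mca : max_completely_alternating l.
Proof.
move=> [//|g gs] f _ gsU fU.
have cvgl := @maxdiff_cvg E R _ l (g :: gs) f
  (fun h => @cvg_mul_oneB_expRN R (l h)).
rewrite -(cvg_lim (@Rhausdorff R) cvgl); apply: limr_le.
  by apply/cvg_ex; eexists; exact: cvgl.
apply: nearW => n.
have -> : (fun f => n.+1%:R * (1 - expR (- (l f / n.+1%:R)))) =
    (fun f => - n.+1%:R * expR (- (l f / n.+1%:R)) + n.+1%:R).
  by apply/funext => h; ring.
rewrite maxdiff_linear maxdiff_cst addr0 mulNr oppr_le0 mulr_ge0//.
have [_ Pc] := @prob_crossing_event n.+1%:R (g :: gs) f (ltr0Sn _ _) gsU fU.
by rewrite -lee_fin -Pc; exact: measure_ge0.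
Qed.

(** A Dini argument on the compact support of [fn 0]: the open sets where [fn n < q] and
    [dens phi < 1 / q] cover it, and the largest index of a finite subcover works everywhere. *)
Lemma decreasing_mul_lt1 phi (fn : nat -> E -> R) f : supmeasure phi ->
  (forall n, USC (fn n)) -> USC f ->
  (forall x, {homo (fun n => fn n x) : n m / (n <= m)%N >-> m <= n}) ->
  (forall x, fn n x @[n --> \oo] --> f x) ->
  (forall x, f x * dens phi x < 1) ->
  exists n, forall x, fn n x * dens phi x < 1.
Proof.
move=> pS fnU fU fmono fcvg fd.
have [_ _ _ c0] := fnU 0%N.
have [|x fx|s sQ sK] := @compact_seq_cover E (nat * rat)%type (supp (fn 0%N))
    (fun c => 0 < (ratr c.2 : R))
    (fun c => [set x | fn c.1 x < ratr c.2] `&` [set x | dens phi x < (ratr c.2)^-1]) c0.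
- move=> c _; apply: openI; last exact: (open_dens_lt hE hb).
  by have [_ _ + _] := fnU c.1.
- have [q [fq q0 dq]] := exists_rat_mul_lt1 (USC_ge0 fU x) (dens_ge0 x pS) (fd x).
  have : \forall n \near \oo, fn n x < ratr q by apply: cvgr_lt fq; exact: fcvg.
  by move=> [n _ /(_ n (leqnn n)) fnq]; exists (n, q).
exists (\max_(c <- s) c.1)%N => x.
have [fx|/supp0 fx] := pselect (supp (fn 0%N) x); last first.
  suff -> : fn (\max_(c <- s) c.1)%N x = 0 by rewrite mul0r.
  apply/le_anti; rewrite (USC_ge0 (fnU _)) andbT -fx; exact: fmono.
have [c cs [fc dc]] := sK x fx.
have q0 := sQ c cs.
apply: (@le_lt_trans _ _ (ratr c.2 * dens phi x)); last first.
  by rewrite mulrC -ltr_pdivlMr// mul1r.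
apply: ler_wpM2r; first exact: dens_ge0.
apply: le_trans (ltW fc); apply: fmono.
exact: (@leq_bigmax_seq _ s xpredT (fun c => c.1)).
Qed.

(** Monotonicity of [l] provides a limit [L >= l f]. The events [eint (fn n) <= 1] increase to a
    union of probability [exp (- L)], and comparison with events of [f] bounds [L] from above. *)
Lemma tail_dep_usc : usc_functional l.
Proof.
move=> fn f fnU fU fmono fcvg.
have f_le n x : f x <= fn n x.
  rewrite -(cvg_lim (@Rhausdorff R) (fcvg x)); apply: limr_le.
    by apply/cvg_ex; exists (f x).
  by exists n => // m /= nm; exact: fmono.
have lmono : {homo (fun n => l (fn n)) : n m / (n <= m)%N >-> m <= n}.
  by move=> n m nm; apply: (mca_le tail_dep_mca) => // x; exact: fmono.
split => //.
have lge n : l f <= l (fn n) by exact: (mca_le tail_dep_mca).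
have cvgl : cvgn (fun n => l (fn n)).
  by apply: nonincreasing_is_cvgn => //; exists (l f) => _ [n _ <-].
pose L := limn (fun n => l (fn n)).
have cvgL : l (fn n) @[n --> \oo] --> L by exact: cvgl.
suff -> : l f = L by [].
have Lle k : L <= l f * (1 + k.+1%:R^-1).
  (* A level below 1 supplies the strict bound needed by [decreasing_mul_lt1], so [eint f <= T]
     implies [eint (fn n) <= 1] for some [n]; its inverse is the factor in the claim. *)
  pose T : R := (1 + k.+1%:R^-1)^-1.
  have T0 : 0 < T by rewrite invr_gt0 addr_gt0.
  have T1 : T < 1 by rewrite invf_lt1 ?addr_gt0// ltrDl.
  have cvgP : P (eint_le_event (fn n) 1) @[n --> \oo] -->
      P (\bigcup_n eint_le_event (fn n) 1).
    have mU : measurable (\bigcup_n eint_le_event (fn n) 1).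
      by apply: bigcupT_measurable => n; exact: measurable_eint_le_event.
    apply: nondecreasing_cvg_mu => //.
      by move=> n; exact: measurable_eint_le_event.
    move=> n m nm; apply/subsetPset => w.
    move=> /(eint_leP hE hb (rX.1 w) (USC_ge0 (fnU n)) ler01) H.
    apply/(eint_leP hE hb (rX.1 w) (USC_ge0 (fnU m)) ler01) => x.
    apply: le_trans (H x); apply: ler_wpM2r; last exact: fmono.
    exact: dens_ge0 (rX.1 w).
  have cvge : P (eint_le_event (fn n) 1) @[n --> \oo] --> (expR (- L))%:E.
    under eq_fun do rewrite prob_eint_le_event// divr1.
    apply: cvg_EFin; first exact: nearW.
    by apply: continuous_cvg; [exact: continuous_expR | exact: cvgN].
  have PE := cvg_unique (@ereal_hausdorff R) cvgP cvge.
  have : (P (eint_le_event f T) <= P (\bigcup_n eint_le_event (fn n) 1))%E.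
    apply: le_measure; rewrite ?inE; first exact: measurable_eint_le_event.
      by apply: bigcupT_measurable => n; exact: measurable_eint_le_event.
    move=> w /(eint_leP hE hb (rX.1 w) (USC_ge0 fU) (ltW T0)) H.
    have [|n nlt] := decreasing_mul_lt1 (rX.1 w) fnU fU fmono fcvg.
      by move=> x; exact: le_lt_trans (H x) T1.
    exists n => //; apply/(eint_leP hE hb (rX.1 w) (USC_ge0 (fnU n)) ler01) => x.
    exact: ltW.
  by rewrite PE prob_eint_le_event// lee_fin ler_expR lerN2 /T invrK.
apply/le_anti/andP; split.
  rewrite -(cvg_lim (@Rhausdorff R) cvgL); apply: limr_ge => //.
  exact: nearW.
have cvgk : l f * (1 + k.+1%:R^-1) @[k --> \oo] --> l f.
  suff : l f * (1 + k.+1%:R^-1) @[k --> \oo] --> l f * (1 + 0).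
    by rewrite addr0 mulr1.
  apply: cvgMl_tmp; apply: cvgD; [exact: cvg_cst | exact: cvg_harmonic].
rewrite -(cvg_lim (@Rhausdorff R) cvgk); apply: limr_ge.
  by apply/cvg_ex; exists (l f).
exact: nearW.
Qed.

End Necessity.

(** * Uniqueness in law *)

Lemma sigma_algebra_subsets (T : Type) (D : set T) (G : set (set T)) :
  G `<=` [set A | A `<=` D] -> <<s D, G >> `<=` [set A | A `<=` D].
Proof.
move=> GD; apply: smallest_sub => //; split => //.
  by move=> A _ x [].
by move=> F FD x [n _ /FD].
Qed.

(** A Dynkin system argument: the two laws agree on the events [eint f <= 1], which are stable under
    intersection through [fmax] and generate [sv_borel]. *)
Lemma tail_dep_law_unique (E : topologicalType) (R : realType) (b : nat -> set E)
    (hE : hausdorff_space E) (hb : nbhs_base b) (l : (E -> R) -> R)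
    (d1 : measure_display) (Omega1 : measurableType d1)
    (P1 : probability Omega1 R) (X1 : Omega1 -> set E -> \bar R)
    (d2 : measure_display) (Omega2 : measurableType d2)
    (P2 : probability Omega2 R) (X2 : Omega2 -> set E -> \bar R) :
  random_supmeasure X1 -> tail_dep P1 X1 l ->
  random_supmeasure X2 -> tail_dep P2 X2 l ->
  forall U, @sv_borel E R U -> P1 (X1 @^-1` U) = P2 (X2 @^-1` U).
Proof.
move=> r1 t1 r2 t2.
pose SM := @supmeasure E R.
pose le1 f := sets_on SM (fun phi => (eint f phi <= 1%:E)%E).
pose G := [set U | exists2 f, USC f & U = le1 f].
pose H := [set U | [/\ U `<=` SM, measurable (X1 @^-1` U),
  measurable (X2 @^-1` U) & P1 (X1 @^-1` U) = P2 (X2 @^-1` U)]].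
have GD : G `<=` [set U | U `<=` SM] by move=> _ [f _ ->] phi [].
suff sub : @sv_borel E R `<=` H by move=> U /sub[].
apply: (@subset_trans _ <<s SM, G >>).
  apply: (sv_borel_sub hE hb); first exact: smallest_sigma_algebra.
  by move=> f fU; apply: sub_sigma_algebra; exists f.
apply: lambda_system_subset; last exact: sigma_algebra_subsets.
- move=> _ _ [f fU ->] [g gU ->]; exists (fmax f g); first exact: USC_fmax.
  apply/seteqP; split => phi.
    move=> [[pS f1] [_ g1]]; split => //.
    exact/(eint_fmax_le hE hb pS fU gU ler01).
  by move=> [pS /(eint_fmax_le hE hb pS fU gU ler01)[]].
- have X1T : X1 @^-1` SM = setT by apply/seteqP; split => // w _; exact: r1.1.
  have X2T : X2 @^-1` SM = setT by apply/seteqP; split => // w _; exact: r2.1.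
  split.
  + by move=> U [].
  + by split; rewrite ?X1T ?X2T// !probability_setT.
  + move=> U V VU [UD m1U m2U PU] [VD m1V m2V PV].
    have PD d (Om : measurableType d) (P : probability Om R) (X : Om -> set E -> \bar R) :
        measurable (X @^-1` U) -> measurable (X @^-1` V) ->
        P (X @^-1` U `\` X @^-1` V) = (P (X @^-1` U) - P (X @^-1` V))%E.
      move=> mU mV.
      have I : X @^-1` U `&` X @^-1` V = X @^-1` V by apply: setIidr => w; exact: VU.
      rewrite -[in RHS]I; apply: measureD => //.
      by apply: le_lt_trans (ltry 1); exact: probability_le1.
    split; rewrite ?preimage_setD; do ?exact: measurableD.
      by move=> phi [/UD].
    by rewrite !PD// PU PV.
  + move=> F Fmono FH; split.
    * by move=> phi [n _]; case: (FH n) => FD _ _ _; exact: FD.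
    * by rewrite preimage_bigcup; apply: bigcupT_measurable => n; case: (FH n).
    * by rewrite preimage_bigcup; apply: bigcupT_measurable => n; case: (FH n).
    * rewrite !preimage_bigcup.
      have c1 : P1 (X1 @^-1` F n) @[n --> \oo] --> P1 (\bigcup_n (X1 @^-1` F n)).
        apply: nondecreasing_cvg_mu.
        - by move=> n; case: (FH n).
        - by apply: bigcupT_measurable => n; case: (FH n).
        - by move=> n m /Fmono/subsetPset nm; apply/subsetPset => w; exact: nm.
      have c2 : P2 (X2 @^-1` F n) @[n --> \oo] --> P2 (\bigcup_n (X2 @^-1` F n)).
        apply: nondecreasing_cvg_mu.
        - by move=> n; case: (FH n).
        - by apply: bigcupT_measurable => n; case: (FH n).
        - by move=> n m /Fmono/subsetPset nm; apply/subsetPset => w; exact: nm.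
      apply: (cvg_unique (@ereal_hausdorff R) c1).
      suff -> : (fun n => P1 (X1 @^-1` F n)) = (fun n => P2 (X2 @^-1` F n)) by [].
      by apply/funext => n; case: (FH n).
- move=> _ [f fU ->]; split; first by move=> phi [].
  + by rewrite preimage_sets_on_eint//; exact: (measurable_eint_le_event hE hb).
  + by rewrite preimage_sets_on_eint//; exact: (measurable_eint_le_event hE hb).
  + by rewrite !preimage_sets_on_eint// (prob_eint_le_event t1)// (prob_eint_le_event t2).
Qed.

Theorem mainTheorem2 (E : topologicalType) (R : realType) (hE : LCHS E) :
  (forall l : (E -> R) -> R, (forall f, USC f -> 0 <= l f) ->
     ((exists (d : measure_display) (Omega : measurableType d)
              (P : probability Omega R) (X : Omega -> set E -> \bar R),
          max_stable P X /\ tail_dep P X l)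
      <-> [/\ homogeneous l, max_completely_alternating l & usc_functional l]))
  /\
  (forall (l : (E -> R) -> R)
          (d1 : measure_display) (Omega1 : measurableType d1)
          (P1 : probability Omega1 R) (X1 : Omega1 -> set E -> \bar R)
          (d2 : measure_display) (Omega2 : measurableType d2)
          (P2 : probability Omega2 R) (X2 : Omega2 -> set E -> \bar R),
      max_stable P1 X1 -> tail_dep P1 X1 l ->
      max_stable P2 X2 -> tail_dep P2 X2 l ->
      forall U, @sv_borel E R U -> P1 (X1 @^-1` U) = P2 (X2 @^-1` U)).
Proof.
have [b hb] := LCHS_nbhs_base hE; have [_ [hausE _]] := hE.
split=> [l l0|l d1 Omega1 P1 X1 d2 Omega2 P2 X2 [r1 _] t1 [r2 _] t2]; last first.
  exact: (tail_dep_law_unique hausE hb r1 t1 r2 t2).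
split; last first.
  move=> [hl al ul].
  have [P [X HX]] := exists_max_stable hausE hb l0 hl al ul.
  by exists _, _, P, X.
case=> d; case=> Omega; case=> P; case=> X; case=> -[rX _] tX.
split.
- exact: (tail_dep_homogeneous hausE hb rX tX).
- exact: (tail_dep_mca hausE hb rX tX).
- exact: (tail_dep_usc hausE hb rX tX).
Qed.
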